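(* For every measurable $h:\mathsf Q_2\to[-1,1]$, \[ \int_{\mathsf Q_2}e^{-\|y\|^2/2}\,\bigl|(S_{\mathsf Q_2}h)(y)\bigr|\,dy\le\frac{\pi^2}{4}\,c_{\mathrm{Kri}} . \] Equality is attained by the constant inputs $h=1$ and $h=-1$.
   Context: Let $\mathsf Q_2:=[0,\infty)^2$ and $c_{\mathrm{Kri}}:=\frac2\pi\log(1+\sqrt2)$. For measurable $h:\mathsf Q_2\to[-1,1]$, the unnormalized quadrant sine operator is \[ (S_{\mathsf Q_2}h)(y):=\int_{\mathsf Q_2}h(x)\,e^{-\|x\|^2/2}\sin\langle x,y\rangle\,dx,\qquad y\in\mathsf Q_2 . \] *)

(* Defs.v *)
From HB Require Import structures.
From mathcomp Require Import all_boot all_order all_algebra.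
From mathcomp Require Import all_classical all_reals all_analysis.

Set Implicit Arguments.
Unset Strict Implicit.
Unset Printing Implicit Defensive.
Import Order.TTheory GRing.Theory Num.Theory.
Import numFieldNormedType.Exports.

Local Open Scope classical_set_scope.
Local Open Scope ring_scope.

(* The product measure lives on the Borel sigma-algebra of R * R; its completion
   (the Caratheodory extension) is the planar Lebesgue measure on all Lebesgue
   measurable sets, just as completed_lebesgue_measure is on the line. *)
Definition borel_plane_measure (R : realType) :
    {measure set (measurableTypeR R * measurableTypeR R) -> \bar R} :=
  (@lebesgue_measure R \x @lebesgue_measure R)%E.

(* Convertible to R * R, with the Lebesgue sigma-algebra. *)
Definition plane (R : realType) : measurableType _ :=
  caratheodory_type (mu_ext (@borel_plane_measure R)).

Definition plane_measure (R : realType) : {measure set (plane R) -> \bar R} :=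
  @completed_measure_extension _ _ _ (@borel_plane_measure R).

Section quadrant.
Context {R : realType}.
Implicit Types x y : R * R.

Definition dot2 x y : R := x.1 * y.1 + x.2 * y.2.

Definition norm2 x : R := Num.sqrt (dot2 x x).

Definition quadrant : set (R * R) := [set x | 0 <= x.1 /\ 0 <= x.2].

Definition c_Kri : R := 2 / pi * ln (1 + Num.sqrt 2).

Definition quadrant_sine (h : R * R -> R) y : R :=
  \int[@plane_measure R]_(x in quadrant)
    (h x * expR (- (norm2 x ^+ 2 / 2)) * sin (dot2 x y)).

Definition quadrant_sine_norm (h : R * R -> R) : \bar R :=
  (\int[@plane_measure R]_(y in quadrant)
    (expR (- (norm2 y ^+ 2 / 2)) * `|quadrant_sine h y|)%:E)%E.

End quadrant.

(* Main.v *)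
Require Import Defs.
From mathcomp Require Import all_boot all_order all_algebra.
From mathcomp Require Import all_classical all_reals all_analysis.
From mathcomp Require Import measurable_realfun ring lra.

Set Implicit Arguments.
Unset Strict Implicit.
Unset Printing Implicit Defensive.
Import Order.TTheory GRing.Theory Num.Theory.
Import numFieldNormedType.Exports.

Local Open Scope classical_set_scope.
Local Open Scope ring_scope.

(** Use slopes and abscissas as coordinates on the open quadrant:
    [x = (u, u * a)] and [y = (v, v * b)] with [u, v, a, b > 0].  Then
    [|x|^2 = (1 + a^2) u^2], [<x, y> = (1 + a b) u v] and [dx = u du da], so on
    the ray of slope [b] the function [S h] is the integral over the slopes [a]
    of one-dimensional sine transforms
      [T f (v) = int_0^oo f(u) u exp(- al u^2 / 2) sin(ga u v) du]
    with [f(u) = h(u, u a)], [al = 1 + a^2] and [ga = 1 + a b].  By the triangle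
    inequality and Tonelli it suffices to show, for each pair of distinct
    slopes and with [be = 1 + b^2], that
      [int_0^oo v exp(- be v^2 / 2) |T f (v)| dv]
    is at most its value at [f = 1] ([ray_bound]).

    Let [tau = T 1].  Explicitly, [tau v] is a constant times
    [v exp(- ga^2 v^2 / (2 al))], whence [v exp(- be v^2 / 2)] is a constant
    times [exp(- s v^2 / 2) tau v] for [s = be - ga^2 / al], and [s > 0] by
    Cauchy-Schwarz.  Since [|T f| tau <= ((T f)^2 + tau^2) / 2], with equality
    at [f = 1], only an inequality of quadratic forms is left:
      [int exp(- s v^2 / 2) (T f (v))^2 dv <= int exp(- s v^2 / 2) (tau v)^2 dv]
    ([sqr_sine_transform_le]).  The left-hand side is the integral of
    [f(u) f(u')] against a positive weight times the kernel
      [int exp(- s v^2 / 2) sin(ga u v) sin(ga u' v) dv],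
    which is half the difference of the cosine transform of a Gaussian at
    [ga (u - u')] and at [ga (u + u')].  That transform is again a Gaussian, so
    the kernel is nonnegative ([gauss_sin_sin_ge0]) and [f = 1] is optimal.

    For [f = 1] the integral over [v] equals [pi / 2 * dir_weight a b]
    ([integral_gauss_sin_ray]), and [dir_weight] has elementary primitives in
    both slopes, giving [ln (1 + sqrt 2)] in total ([integral_dir_weight],
    [integral_dir_marginal]).  When [h = 1] every transform [tau] is
    nonnegative, so no step loses anything and the bound is attained.

    This argument runs on Borel functions, to which Fubini applies; a Lebesgue
    measurable input is almost everywhere equal to a Borel one
    ([borel_modification]) and has the same transform. *)


(** * Iterated integrals over rectangles *)

Section iterated_integrals.
Local Open Scope ereal_scope.
Context d1 d2 (T1 : measurableType d1) (T2 : measurableType d2) (R : realType).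
Variable m1 : {sigma_finite_measure set T1 -> \bar R}.
Variable m2 : {sigma_finite_measure set T2 -> \bar R}.
Variables (D1 : set T1) (D2 : set T2).
Hypotheses (mD1 : measurable D1) (mD2 : measurable D2).
Implicit Types f : T1 * T2 -> \bar R.

Let mD : measurable (D1 `*` D2). Proof. exact: measurableX. Qed.

Lemma patch_setX f x y : (f \_ (D1 `*` D2)) (x, y) =
  ((fun x => ((fun y => f (x, y)) \_ D2) y) \_ D1) x.
Proof. by rewrite !patchE in_setX/=; case: (x \in D1); case: (y \in D2). Qed.

(** Extending by zero turns integrals over a rectangle into integrals over the
    whole product, to which the Fubini theorems apply. *)
Lemma iterated_integral_patch f :
  \int[m1]_(x in D1) \int[m2]_(y in D2) f (x, y) =
  \int[m1]_x \int[m2]_y (f \_ (D1 `*` D2)) (x, y).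
Proof.
rewrite integral_mkcond; apply: eq_integral => x _.
rewrite patchE; case: ifPn => [xD|xD].
  rewrite integral_mkcond; apply: eq_integral => y _.
  by rewrite patch_setX [RHS]patchE xD.
rewrite (eq_integral (cst 0)) ?integral0// => y _.
by rewrite patch_setX patchE (negbTE xD).
Qed.

Lemma iterated_integral_patchC f :
  \int[m2]_(y in D2) \int[m1]_(x in D1) f (x, y) =
  \int[m2]_y \int[m1]_x (f \_ (D1 `*` D2)) (x, y).
Proof.
rewrite integral_mkcond; apply: eq_integral => y _.
rewrite patchE; case: ifPn => [yD|yD].
  rewrite integral_mkcond; apply: eq_integral => x _.
  by rewrite patch_setX patchE [RHS]patchE patchE yD.
rewrite (eq_integral (cst 0)) ?integral0// => x _.
by rewrite patch_setX !patchE (negbTE yD) if_same.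
Qed.

Let mpatch f : measurable_fun (D1 `*` D2) f ->
  measurable_fun setT (f \_ (D1 `*` D2)).
Proof. by move=> mf; exact/(measurable_restrictT _ mD). Qed.

Let patch_ge0 f : (forall z, 0 <= f z) -> forall z, 0 <= (f \_ (D1 `*` D2)) z.
Proof. by move=> f0 z; rewrite patchE; case: ifP. Qed.

Lemma ge0_integral_setX f : measurable_fun (D1 `*` D2) f ->
    (forall z, 0 <= f z) ->
  \int[(m1 \x m2)%E]_(z in D1 `*` D2) f z =
  \int[m1]_(x in D1) \int[m2]_(y in D2) f (x, y).
Proof.
move=> mf f0; rewrite integral_mkcond fubini_tonelli1//.
- by rewrite iterated_integral_patch.
- exact: mpatch.
- exact: patch_ge0.
Qed.

Lemma tonelli_setX f : measurable_fun (D1 `*` D2) f -> (forall z, 0 <= f z) ->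
  \int[m1]_(x in D1) \int[m2]_(y in D2) f (x, y) =
  \int[m2]_(y in D2) \int[m1]_(x in D1) f (x, y).
Proof.
move=> mf f0; rewrite iterated_integral_patch iterated_integral_patchC.
by apply: fubini_tonelli; [exact: mpatch|exact: patch_ge0].
Qed.

Lemma integrable_setX f : measurable_fun (D1 `*` D2) f ->
  \int[m1]_(x in D1) \int[m2]_(y in D2) `|f (x, y)| < +oo ->
  (m1 \x m2)%E.-integrable (D1 `*` D2) f.
Proof.
move=> mf foo; apply/integrableP; split => //.
rewrite (@ge0_integral_setX (abse \o f))//.
  apply: measurableT_comp => //; exact: mf.
by move=> z /=; exact: abse_ge0.
Qed.

Let ipatch f : (m1 \x m2)%E.-integrable (D1 `*` D2) f ->
  (m1 \x m2)%E.-integrable setT (f \_ (D1 `*` D2)).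
Proof. by move=> If; exact/(integrable_mkcond _ mD). Qed.

Lemma integral_setX f : (m1 \x m2)%E.-integrable (D1 `*` D2) f ->
  \int[(m1 \x m2)%E]_(z in D1 `*` D2) f z =
  \int[m1]_(x in D1) \int[m2]_(y in D2) f (x, y).
Proof.
move=> If; rewrite integral_mkcond iterated_integral_patch.
by rewrite [RHS]integral12_prod_meas1//; exact: ipatch.
Qed.

Lemma fubini_setX f : (m1 \x m2)%E.-integrable (D1 `*` D2) f ->
  \int[m1]_(x in D1) \int[m2]_(y in D2) f (x, y) =
  \int[m2]_(y in D2) \int[m1]_(x in D1) f (x, y).
Proof.
move=> If; rewrite iterated_integral_patch iterated_integral_patchC.
by apply: Fubini; exact: ipatch.
Qed.

End iterated_integrals.

(** * Measurability of integrals depending on a parameter *)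

Section parameter.
Context d1 d2 (T1 : measurableType d1) (T2 : measurableType d2) (R : realType).
Variable m2 : {sigma_finite_measure set T2 -> \bar R}.
Variables (D2 : set T2) (mD2 : measurable D2).

Lemma measurable_ge0_integral_parameter (f : T1 * T2 -> \bar R) :
  measurable_fun setT f -> (forall z, (0 <= f z)%E) ->
  measurable_fun setT (fun x => \int[m2]_(y in D2) f (x, y))%E.
Proof.
move=> mf f0.
have mD : measurable ([set: T1] `*` D2) by exact: measurableX.
have := @measurable_fun_fubini_tonelli_F _ _ T1 T2 R m2 (f \_ (setT `*` D2)).
rewrite /fubini_F => H.
rewrite (_ : (fun x => _) =
    fun x => (\int[m2]_y (f \_ ([set: T1] `*` D2)) (x, y))%E).
  apply: H => [|z]; last by rewrite patchE; case: ifP.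
  by apply/(measurable_restrictT _ mD); exact: measurable_funTS.
apply/funext => x; rewrite integral_mkcond; apply: eq_integral => y _.
by rewrite !patchE in_setX/= in_setT.
Qed.

Lemma measurable_Rintegral_parameter (f : T1 * T2 -> R) :
  measurable_fun setT f ->
  measurable_fun setT (fun x => \int[m2]_(y in D2) f (x, y)).
Proof.
move=> mf; apply: (measurableT_comp (f := fine)) => //.
under eq_fun do rewrite integralE.
have mF : measurable_fun setT (EFin \o f) by exact/measurable_EFinP.
apply: emeasurable_funB.
- rewrite (_ : (fun x => _) =
      fun x => \int[m2]_(y in D2) (EFin \o f)^\+ (x, y))%E.
    by apply: measurable_ge0_integral_parameter;
      [exact: measurable_funepos|move=> z; exact: funepos_ge0].
  by apply/funext => x; apply: eq_integral => y _; rewrite !funeposE.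
- rewrite (_ : (fun x => _) =
      fun x => \int[m2]_(y in D2) (EFin \o f)^\- (x, y))%E.
    by apply: measurable_ge0_integral_parameter;
      [exact: measurable_funeneg|move=> z; exact: funeneg_ge0].
  by apply/funext => x; apply: eq_integral => y _; rewrite !funenegE.
Qed.

End parameter.

(** * Integration on the half-line: dilations and primitives *)

Section scaling.
Context {R : realType}.
Local Notation mu := (@lebesgue_measure R).
Local Notation P := (`]0%R, +oo[%classic : set R).
Local Open Scope ereal_scope.

Lemma measurable_scale (k : R) :
  measurable_fun setT ((fun x => k * x)%R : measurableTypeR R -> measurableTypeR R).
Proof. exact: mulrl_measurable. Qed.

(** Both sides are measures agreeing on the intervals [`]a, b]]. *)
Lemma lebesgue_measure_scale (k : {posnum R}) (A : set (measurableTypeR R)) :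
  measurable A -> mu A = (k%:num)%:E * mu ((fun x => k%:num * x)%R @^-1` A).
Proof.
pose phi := (fun x => k%:num * x)%R : measurableTypeR R -> measurableTypeR R.
have mphi : measurable_fun setT phi := measurable_scale k%:num.
pose nu : {measure set (measurableTypeR R) -> \bar R} := pushforward mu phi.
apply: (@lebesgue_measure_unique _ (mscale (NngNum (ltW (gt0 k))) (nu mphi))).
move=> _ [[a b] _ <-]; rewrite /mscale/= /pushforward/=.
have E : phi @^-1` `]a, b]%classic = `](a / k%:num)%R, (b / k%:num)%R]%classic.
  apply/seteqP; split => x /=; rewrite !in_itv/= /phi;
    by rewrite ltr_pdivrMr// ler_pdivlMr// (mulrC x).
transitivity ((k%:num)%:E * mu `](a / k%:num)%R, (b / k%:num)%R]%classic);
  last by rewrite -E.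
rewrite !lebesgue_measure_itv/= !lte_fin ltr_pM2r ?invr_gt0//.
case: ifPn => _; last by rewrite mule0.
by rewrite -EFinB -EFinM -mulrBl mulrCA divff ?mulr1.
Qed.

Lemma halfline_scale (k : R) : (0 < k)%R ->
  (fun x => k * x)%R @^-1` P = P.
Proof.
move=> k0; apply/seteqP; split => x /=; rewrite !in_itv/= !andbT.
  by rewrite pmulr_rgt0.
by move=> ?; rewrite mulr_gt0.
Qed.

Lemma ge0_integral_scale (k : R) (F : R -> \bar R) : (0 < k)%R ->
  measurable_fun P F -> (forall x, 0 <= F x) ->
  \int[mu]_(x in P) F x = k%:E * \int[mu]_(x in P) F (k * x)%R.
Proof.
move=> k0 mF F0.
pose phi := (fun x => k * x)%R : measurableTypeR R -> measurableTypeR R.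
have mphi : measurable_fun setT phi := measurable_scale k.
pose nu : {measure set (measurableTypeR R) -> \bar R} := pushforward mu phi.
transitivity (\int[mscale (NngNum (ltW k0)) (nu mphi)]_(x in P) F x).
  apply: eq_measure_integral => A mA _ /=.
  by rewrite /mscale/= (lebesgue_measure_scale (PosNum k0)).
rewrite ge0_integral_mscale//; congr (_ * _).
by rewrite ge0_integral_pushforward//= ?halfline_scale.
Qed.

Lemma integral_scale (k : R) (F : R -> \bar R) : (0 < k)%R ->
  measurable_fun setT F ->
  \int[mu]_(x in P) F x = \int[mu]_(x in P) (k%:E * F (k * x)%R).
Proof.
move=> k0 mF; have kP : (0 <= k)%R by exact: ltW.
have mFk : measurable_fun setT (fun x => F (k * x)%R).
  exact: (measurableT_comp mF (measurable_scale k)).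
rewrite integralE [RHS]integralE; congr (_ - _).
  rewrite (ge0_integral_scale k0)//; last first.
    by apply: measurable_funTS; exact: measurable_funepos.
  rewrite -ge0_integralZl//; last first.
    apply: measurable_funTS.
    exact: (measurableT_comp (measurable_funepos mF) (measurable_scale k)).
  apply: eq_integral => x _.
  by rewrite !funeposE maxe_pMr// ?mule0// lee_fin.
rewrite (ge0_integral_scale k0)//; last first.
  by apply: measurable_funTS; exact: measurable_funeneg.
rewrite -ge0_integralZl//; last first.
  apply: measurable_funTS.
  exact: (measurableT_comp (measurable_funeneg mF) (measurable_scale k)).
apply: eq_integral => x _.
by rewrite !funenegE maxe_pMr// ?mule0// -muleN.
Qed.

End scaling.

Section signed_FTC.
Context {R : realType}.
Local Notation mu := (@lebesgue_measure R).
Local Notation P := (`]0%R, +oo[%classic : set R).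

(** The fundamental theorem on [`[0, n]], and dominated convergence as [n] tends
    to infinity. *)
Lemma Rintegral_halfline_derive (F f : R -> R) (l : R) :
  continuous f -> mu.-integrable P (EFin \o f) ->
  (forall x : R, is_derive x 1 F (f x)) -> F x @[x --> +oo] --> l ->
  \int[mu]_(x in P) f x = l - F 0.
Proof.
move=> cf If dF Fl.
have mf : measurable_fun setT f by exact: continuous_measurable_fun.
pose f_ (n : nat) (x : R) : \bar R := (EFin \o f \_ `]0%R, n%:R]) x.
have mf_ n : measurable_fun P (f_ n).
  apply: measurable_funTS; apply/measurable_EFinP.
  by apply/(measurable_restrictT _ (measurable_itv _)); exact: measurable_funTS.
have f_f : {ae mu, forall x, P x -> f_ n x @[n --> \oo] --> (f x)%:E}.
  apply/aeW => x Px; apply: cvg_near_cst; near=> n.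
  rewrite /f_/= patchE mem_set//= in_itv/=.
  move: Px; rewrite /= in_itv/= andbT => ->/=.
  by near: n; exact: nbhs_infty_ger.
have bnd : {ae mu, forall x n, P x -> (`|f_ n x| <= (EFin \o (Num.norm \o f)) x)%E}.
  apply/aeW => x n _; rewrite /f_/= lee_fin patchE.
  by case: ifP; rewrite ?normr0.
have Inf : mu.-integrable P (EFin \o (Num.norm \o f)) by exact: integrable_norm.
have mEf : measurable_fun P (EFin \o f).
  by apply/measurable_EFinP; exact: measurable_funTS.
have [_ _] := @dominated_convergence _ _ _ mu P (measurable_itv _) f_ (EFin \o f)
  (EFin \o (Num.norm \o f)) mf_ mEf f_f Inf bnd.
have Ef_ n : (\int[mu]_(x in P) f_ n x = (F n%:R - F 0)%:E)%E.
  rewrite /f_ [LHS](_ : _ = \int[mu]_(x in `]0%R, n%:R]) (f x)%:E)%E; last first.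
    rewrite [RHS]integral_mkcond [LHS]integral_mkcond.
    apply: eq_integral => x _; rewrite !patchE/= patchE.
    case: ifPn => xP; case: ifPn => // xn.
    move: xP xn; rewrite notin_setE/= => xP /set_mem/=.
    by rewrite !in_itv/= => /andP[x0 _]; move: xP; rewrite in_itv/= x0.
  have [->|n0] := eqVneq n 0%N.
    by rewrite subrr set_itvoc0 integral_set0.
  have n0' : (0 : R) < n%:R by rewrite ltr0n lt0n.
  rewrite integral_itv_obnd_cbnd; last first.
    by apply/measurable_EFinP; exact: measurable_funTS.
  rewrite (continuous_FTC2 (F := F))//.
  - exact: continuous_subspaceT.
  - have cF : continuous F.
      move=> x; apply: differentiable_continuous; apply/derivable1_diffP.
      by have [] := dF x.
    split.
    + by move=> x _; have [] := dF x.
    + by apply: cvg_at_right_filter; exact: cF.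
    + by apply: cvg_at_left_filter; exact: cF.
  - by move=> x _; rewrite derive1E; have [_] := dF x.
have EE : (fun n => \int[mu]_(x in P) f_ n x)%E = (fun n : nat => (F n%:R - F 0)%:E).
  by apply/funext => n; exact: Ef_.
rewrite EE => H.
have /cvg_unique : (F n%:R - F 0)%:E @[n --> \oo] --> (l - F 0)%:E.
  apply: cvg_EFin; first exact: nearW.
  apply: cvgB; last exact: cvg_cst.
  by move/cvg_pinftyP : Fl; apply; exact: cvgr_idn.
move=> /(_ (@ereal_hausdorff R) _ H) lE.
by rewrite /Rintegral -[X in fine X]/(\int[mu]_(x in P) (EFin \o f) x)%E -lE.
Unshelve. all: end_near. Qed.

End signed_FTC.

(** * Gaussian integrals and transforms *)

Section gauss.
Context {R : realType}.
Local Notation mu := (@lebesgue_measure R).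
Local Notation P := (`]0%R, +oo[%classic : set R).
Implicit Types (s t u : R).

Definition gauss s u : R := expR (- (s * u ^+ 2 / 2)).

Lemma gauss_ge0 s u : 0 <= gauss s u. Proof. exact: expR_ge0. Qed.

Lemma gauss0 s : gauss s 0 = 1.
Proof. by rewrite /gauss expr0n mulr0 mul0r oppr0 expR0. Qed.

Lemma gaussD s s' u : gauss (s + s') u = gauss s u * gauss s' u.
Proof. by rewrite /gauss -expRD; congr expR; ring. Qed.

Global Instance is_derive_gauss s u :
  is_derive u 1 (gauss s) (- (s * u) * gauss s u).
Proof.
have E : is_derive u 1 (fun x => - (s * x ^+ 2 / 2)) (- (s * u)).
  rewrite (_ : (fun x => _) = (- (s / 2)) *: (id * id)); last first.
    by apply/funext => x; rewrite !fctE /GRing.scale/=; ring.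
  by apply: is_derive_eq; rewrite /GRing.scale/=; field.
by rewrite mulrC; apply: is_derive1_comp.
Qed.

Lemma continuous_gauss s : continuous (gauss s).
Proof.
move=> u; apply: differentiable_continuous; apply/derivable1_diffP.
by have [] := is_derive_gauss s u.
Qed.

Lemma measurable_gauss s : measurable_fun setT (gauss s).
Proof. by apply: continuous_measurable_fun; exact: continuous_gauss. Qed.

Lemma gauss_gauss_fun s u : 0 < s -> gauss s u = gauss_fun (Num.sqrt (s / 2) * u).
Proof.
move=> s0; rewrite /gauss /gauss_fun exprMn sqr_sqrtr ?divr_ge0 ?ltW//.
by congr expR; ring.
Qed.

Lemma integral_gauss s : 0 < s ->
  (\int[mu]_(u in P) (gauss s u)%:E = (Num.sqrt (pi / (2 * s)))%:E)%E.
Proof.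
move=> s0; have k0 : 0 < Num.sqrt (2 / s) by rewrite sqrtr_gt0 divr_gt0.
have k1 : Num.sqrt (s / 2) * Num.sqrt (2 / s) = 1.
  rewrite -sqrtrM ?divr_ge0 ?ltW// (_ : s / 2 * (2 / s) = 1) ?sqrtr1//.
  by field; rewrite gt_eqF.
rewrite (ge0_integral_scale k0); last 2 first.
- by apply/measurable_EFinP/measurable_funTS; exact: measurable_gauss.
- by move=> x; rewrite lee_fin gauss_ge0.
under eq_integral do rewrite gauss_gauss_fun// mulrA k1 mul1r.
rewrite integral_itv_obnd_cbnd; last first.
  by apply/measurable_EFinP/measurable_funTS; exact: measurable_gauss_fun.
rewrite integral0y_gauss -EFinM; congr EFin.
rewrite (_ : pi / (2 * s) = (2 / s) * pi / 2 ^+ 2); last first.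
  by field; rewrite gt_eqF.
have s20 : 0 <= 2 / s by rewrite divr_ge0// ltW.
rewrite (sqrtrM _ (mulr_ge0 s20 (pi_ge0 R))) (sqrtrM _ s20).
by rewrite sqrtrV// sqrtr_sqr ger0_norm// mulrA.
Qed.

Lemma integrable_gauss_bound (h : R -> R) (c s : R) : 0 < s ->
  measurable_fun setT h -> (forall u, 0 < u -> `|h u| <= c * gauss s u) ->
  mu.-integrable P (EFin \o h).
Proof.
move=> s0 mh hc.
have Ig : mu.-integrable P (EFin \o gauss s).
  apply/integrableP; split.
    by apply/measurable_EFinP/measurable_funTS; exact: measurable_gauss.
  under eq_integral do rewrite /= ger0_norm ?gauss_ge0//.
  by rewrite integral_gauss// ltry.
apply: (@le_integrable _ _ _ mu P _ _ (fun u => c%:E * (EFin \o gauss s) u)%E).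
- exact: measurable_itv.
- by apply/measurable_EFinP; exact: measurable_funTS.
- move=> u; rewrite /= in_itv/= andbT lee_fin => u0.
  by rewrite (le_trans (hc _ u0))// ler_norm.
- exact: integrableZl.
Qed.

(** Half of the Gaussian absorbs the square, by [1 + y <= expR y] at
    [y = s u^2 / 4]. *)
Lemma sqr_gauss_le s u : 0 < s -> u ^+ 2 * gauss s u <= 4 / s * gauss (s / 2) u.
Proof.
move=> s0; rewrite {1}(_ : s = s / 2 + s / 2); last by field.
rewrite gaussD mulrA ler_wpM2r ?gauss_ge0//.
rewrite /gauss expRN ler_pdivrMr ?expR_gt0//.
rewrite mulrC -ler_pdivrMr ?divr_gt0//.
apply: (le_trans _ (expR_ge1Dx _)).
have -> : u ^+ 2 / (4 / s) = s / 2 * u ^+ 2 / 2 by field; rewrite gt_eqF.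
by rewrite lerDr.
Qed.

Lemma mul_gauss_le s u : 0 < s -> 0 < u ->
  u * gauss s u <= (1 + 4 / s) * gauss (s / 2) u.
Proof.
move=> s0 u0; have := sqr_gauss_le u s0.
have : gauss s u <= gauss (s / 2) u.
  rewrite /gauss ler_expR lerN2 (mulrAC s).
  by have := mulr_gt0 s0 (exprn_gt0 2 u0); lra.
have := gauss_ge0 s u.
set g := gauss s u; set h := gauss _ _ => g0 gh uh.
have : u * g <= g + u ^+ 2 * g.
  by have := mulr_ge0 g0 (sqr_ge0 (u - 2^-1)); rewrite sqrrB; nra.
by move=> /le_trans; apply; rewrite mulrDl mul1r lerD.
Qed.

Lemma integrable_mul_gauss s (b : R -> R) : 0 < s -> measurable_fun setT b ->
  (forall u, `|b u| <= 1) ->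
  mu.-integrable P (EFin \o (fun u => u * gauss s u * b u)).
Proof.
move=> s0 mb b1; apply: (@integrable_gauss_bound _ (1 + 4 / s) (s / 2)).
- by rewrite divr_gt0.
- apply: measurable_funM => //; apply: measurable_funM => //.
  exact: measurable_gauss.
- move=> u u0; rewrite normrM (le_trans (ler_piMr _ (b1 _)))// ger0_norm.
    exact: mul_gauss_le.
  by rewrite mulr_ge0 ?gauss_ge0// ltW.
Qed.

Lemma integrable_gauss s (b : R -> R) : 0 < s -> measurable_fun setT b ->
  (forall u, `|b u| <= 1) ->
  mu.-integrable P (EFin \o (fun u => gauss s u * b u)).
Proof.
move=> s0 mb b1; apply: (@integrable_gauss_bound _ 1 s) => //.
- by apply: measurable_funM => //; exact: measurable_gauss.
- move=> u u0; rewrite normrM (le_trans (ler_piMr _ (b1 _)))//.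
  by rewrite mul1r ger0_norm ?gauss_ge0.
Qed.

Lemma integrable_sqr_gauss s : 0 < s ->
  mu.-integrable P (EFin \o (fun u => u ^+ 2 * gauss s u)).
Proof.
move=> s0; apply: (@integrable_gauss_bound _ (4 / s) (s / 2)).
- by rewrite divr_gt0.
- by apply: measurable_funM => //; exact: measurable_gauss.
- move=> u u0; rewrite ger0_norm; first exact: sqr_gauss_le.
  by rewrite mulr_ge0 ?gauss_ge0// exprn_ge0// ltW.
Qed.

Lemma cvg_gauss s : 0 < s -> gauss s u @[u --> +oo] --> 0.
Proof.
move=> s0; under eq_fun do rewrite gauss_gauss_fun//.
apply: (cvg_comp (fun u => Num.sqrt (s / 2) * u) gauss_fun _ cvg_gauss_fun).
by apply: gt0_cvgMry; [rewrite sqrtr_gt0 divr_gt0|exact: cvg_id].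
Qed.

Lemma cvg_gauss_bound (h : R -> R) (c s : R) : 0 < s ->
  (forall u, 0 < u -> `|h u| <= c * gauss s u) -> h u @[u --> +oo] --> 0.
Proof.
move=> s0 hc; apply: norm_cvg0.
apply: (@squeeze_cvgr _ _ _ _ (cst 0) (fun u => c * gauss s u)).
- near=> u; rewrite /= normr_ge0/= hc//.
- exact: cvg_cst.
- by rewrite -[X in _ --> X](mulr0 c); apply: cvgMr; exact: cvg_gauss.
Unshelve. all: end_near. Qed.

Lemma measurable_mul_sin t : measurable_fun setT (fun u : R => sin (t * u)).
Proof.
apply: continuous_measurable_fun => u; apply: continuous_comp.
  exact: mulrl_continuous.
exact: continuous_sin.
Qed.

Lemma measurable_mul_cos t : measurable_fun setT (fun u : R => cos (t * u)).
Proof.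
apply: continuous_measurable_fun => u; apply: continuous_comp.
  exact: mulrl_continuous.
exact: continuous_cos.
Qed.

Lemma is_derive_sin_mul t u : is_derive u 1 (fun x => sin (t * x)) (t * cos (t * u)).
Proof.
have E : is_derive u 1 (fun x => t * x) t.
  rewrite (_ : (fun x => _) = t *: id)//.
  by apply: is_derive_eq; rewrite /GRing.scale/= mulr1.
by rewrite mulrC; exact: is_derive1_comp.
Qed.

Lemma is_derive_cos_mul t u : is_derive t 1 (fun x => cos (x * u)) (- (u * sin (t * u))).
Proof.
have E : is_derive t 1 (fun x => x * u) u.
  rewrite (_ : (fun x => _) = u *: id); last first.
    by apply/funext => x; rewrite mulrC.
  by apply: is_derive_eq; rewrite /GRing.scale/= mulr1.
by rewrite mulrC -mulNr; exact: is_derive1_comp.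
Qed.

Definition gauss_cos s t := \int[mu]_(u in P) (gauss s u * cos (t * u)).

Definition gauss_sin s t := \int[mu]_(u in P) (u * gauss s u * sin (t * u)).

Lemma gauss_cos0 s : 0 < s -> gauss_cos s 0 = Num.sqrt (pi / (2 * s)).
Proof.
move=> s0; rewrite /gauss_cos /Rintegral.
under eq_integral do rewrite mul0r cos0 mulr1.
by rewrite integral_gauss.
Qed.

(** Integration by parts: [gauss s u * sin (t * u)] vanishes at both ends of the
    half-line. *)
Lemma gauss_sinE s t : 0 < s -> s * gauss_sin s t = t * gauss_cos s t.
Proof.
move=> s0.
have D u : is_derive u 1 (fun u => gauss s u * sin (t * u))
    (t * (gauss s u * cos (t * u)) - s * (u * gauss s u * sin (t * u))).
  have E := is_derive_sin_mul t u.
  rewrite (_ : (fun u => _) = gauss s * (fun u => sin (t * u)))//.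
  by apply: is_derive_eq; rewrite /GRing.scale/=; ring.
have Ic : mu.-integrable P (EFin \o (fun u => gauss s u * cos (t * u))).
  apply: integrable_gauss => //; first exact: measurable_mul_cos.
  by move=> u; exact: cos_max.
have Is : mu.-integrable P (EFin \o (fun u => u * gauss s u * sin (t * u))).
  apply: integrable_mul_gauss => //; first exact: measurable_mul_sin.
  by move=> u; exact: sin_max.
have tIc : mu.-integrable P (EFin \o (fun u => t * (gauss s u * cos (t * u)))).
  by under [_ \o _]eq_fun do rewrite /= EFinM; exact: integrableZl.
have sIs : mu.-integrable P (EFin \o (fun u => s * (u * gauss s u * sin (t * u)))).
  by under [_ \o _]eq_fun do rewrite /= EFinM; exact: integrableZl.
have := @Rintegral_halfline_derive R _ _ 0 _ _ D.
rewrite mulr0 sin0 mulr0 subrr RintegralB//.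
rewrite !RintegralZl//.
move=> H; apply/esym/eqP; rewrite -subr_eq0; apply/eqP; apply: H.
- move=> u; apply: cvgB; apply: cvgMr.
    apply: cvgM; first exact: continuous_gauss.
    apply: continuous_comp; first exact: mulrl_continuous.
    exact: continuous_cos.
  apply: cvgM.
    by apply: cvgM; [exact: cvg_id|exact: continuous_gauss].
  apply: continuous_comp; first exact: mulrl_continuous.
  exact: continuous_sin.
- by under [_ \o _]eq_fun do rewrite /= EFinB; exact: integrableB.
- apply: (@cvg_gauss_bound _ 1 s) => // u u0.
  rewrite normrM mul1r ger0_norm ?gauss_ge0//.
  by rewrite ler_piMr ?gauss_ge0//; exact: sin_max.
Qed.

Lemma is_derive_gauss_cos s t : 0 < s ->
  is_derive t 1 (gauss_cos s) (- gauss_sin s t).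
Proof.
move=> s0; pose f (t u : R) := gauss s u * cos (t * u).
have D (x u : R) : is_derive x 1 (f ^~ u) (- (u * gauss s u * sin (x * u))).
  have E := is_derive_cos_mul x u.
  rewrite (_ : f ^~ u = gauss s u *: (fun x => cos (x * u)))//.
  by apply: is_derive_eq; rewrite /GRing.scale/=; ring.
have d1f x u : partial1of2 f x u = - (u * gauss s u * sin (x * u)).
  by rewrite partial1of2E; have [_] := D x u.
have I x : mu.-integrable P (EFin \o f x).
  apply: integrable_gauss => //; first exact: measurable_mul_cos.
  by move=> u; exact: cos_max.
have tI : t \in `](t - 1), (t + 1)[.
  by rewrite in_itv/= ltrBlDr ltrDl ltr01.
pose G (u : R) := `|u * gauss s u|.
have IG : mu.-integrable P (EFin \o G).
  have := @integrable_mul_gauss s (cst 1) s0 (measurable_cst _).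
  move=> /(_ (fun=> _)) H; apply: integrable_norm.
  apply: eq_integrable (H _) => //; last by move=> u; rewrite /= normr1.
  by move=> u _ /=; rewrite mulr1.
have bG x u : `](t - 1), (t + 1)[%classic x -> P u -> `|partial1of2 f x u| <= G u.
  by move=> _ _; rewrite d1f normrN normrM ler_piMr//; exact: sin_max.
have mP : @measurable _ (measurableTypeR R) P by exact: measurable_itv.
have df x y : `](t - 1), (t + 1)[%classic x -> P y -> derivable (f ^~ y) x 1.
  by move=> _ _; have [] := D x y.
have G0 u : 0 <= G u by exact: normr_ge0.
rewrite -[gauss_cos s]/(fun x => \int[mu]_(u in P) f x u).
apply: DeriveDef.
  exact: (@derivable_under_integral _ _ (measurableTypeR R) mu f P mP _ _ _ tI
    (fun x _ => I x) df G G0 IG bG).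
rewrite -derive1E.
rewrite (@differentiation_under_integral _ _ (measurableTypeR R) mu f P mP _ _ _ tI
  (fun x _ => I x) df G G0 IG bG).
rewrite /gauss_sin -[RHS]mulN1r -RintegralZl//; last first.
  apply: integrable_mul_gauss => //; first exact: measurable_mul_sin.
  by move=> u; exact: sin_max.
by apply: eq_Rintegral => u _; rewrite d1f mulN1r.
Qed.

(** Differentiating under the integral sign and using [gauss_sinE], the cosine
    transform solves the linear equation [C' = - (t / s) C]; hence its quotient by
    [gauss s^-1] is constant. *)
Lemma gauss_cosE s t : 0 < s ->
  gauss_cos s t = Num.sqrt (pi / (2 * s)) * gauss s^-1 t.
Proof.
move=> s0.
have C : gauss_cos s t * gauss (- s^-1) t = gauss_cos s 0 * gauss (- s^-1) 0.
  pose h := gauss_cos s * gauss (- s^-1).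
  suff: h t = h 0 by [].
  apply: is_derive_0_is_cst => x.
  have E := is_derive_gauss_cos x s0.
  apply: is_derive_eq; rewrite /GRing.scale/=.
  have := gauss_sinE x s0.
  move/(congr1 (fun y => s^-1 * y)).
  rewrite mulKf ?gt_eqF// => ->.
  ring.
rewrite gauss0 mulr1 gauss_cos0// in C.
rewrite -C -mulrA -gaussD addNr.
by rewrite /gauss !mul0r oppr0 expR0 mulr1.
Qed.

(** Integration by parts, from the derivative of [u * gauss s u]. *)
Lemma integral_sqr_gauss s : 0 < s ->
  (\int[mu]_(u in P) (u ^+ 2 * gauss s u)%:E = (Num.sqrt (pi / (2 * s)) / s)%:E)%E.
Proof.
move=> s0.
have D u : is_derive u 1 (fun u => u * gauss s u)
    (gauss s u * 1 - s * (u ^+ 2 * gauss s u)).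
  rewrite (_ : (fun u => _) = id * gauss s)//.
  by apply: is_derive_eq; rewrite /GRing.scale/=; ring.
have Ic : mu.-integrable P (EFin \o (fun u => gauss s u * 1)).
  by apply: (@integrable_gauss _ (cst 1)) => // u; rewrite /= normr1.
have Is := integrable_sqr_gauss s0.
have sIs : mu.-integrable P (EFin \o (fun u => s * (u ^+ 2 * gauss s u))).
  by under [_ \o _]eq_fun do rewrite /= EFinM; exact: integrableZl.
have := @Rintegral_halfline_derive R _ _ 0 _ _ D.
rewrite mul0r subrr RintegralB// RintegralZl//.
have -> : \int[mu]_(x in P) (gauss s x * 1) = Num.sqrt (pi / (2 * s)).
  rewrite -gauss_cos0// /gauss_cos; apply: eq_Rintegral => u _.
  by rewrite mul0r cos0.
move=> H; rewrite -[LHS]fineK; last exact: integrable_fin_num.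
congr EFin; rewrite -[LHS]/(\int[mu]_(u in P) (u ^+ 2 * gauss s u)).
apply: (@mulfI _ s); first by rewrite gt_eqF.
rewrite [RHS]mulrC divfK ?gt_eqF//.
apply/esym/eqP; rewrite -subr_eq0; apply/eqP; apply: H.
- move=> u; apply: cvgB.
    by apply: cvgM; [exact: continuous_gauss|exact: cvg_cst].
  apply: cvgMr; apply: cvgM; [exact: exprn_continuous|exact: continuous_gauss].
- by under [_ \o _]eq_fun do rewrite /= EFinB; exact: integrableB.
- apply: (@cvg_gauss_bound _ (1 + 4 / s) (s / 2)); first by rewrite divr_gt0.
  move=> u u0; rewrite ger0_norm; first exact: mul_gauss_le.
  by rewrite mulr_ge0 ?gauss_ge0// ltW.
Qed.

End gauss.

(** * Integral transforms with a bounded kernel *)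

Section bounded_kernel.
Context {R : realType}.
Local Notation mu := (@lebesgue_measure R).
Local Notation P := (`]0%R, +oo[%classic : set R).
Implicit Types (p q b : R -> R) (k : R * R -> R).

Let mP : measurable (P : set (measurableTypeR R)). Proof. exact: measurable_itv. Qed.

Lemma integrable_mul_bounded q b (B : R) : mu.-integrable P (EFin \o q) ->
  measurable_fun setT b -> (forall x, `|b x| <= B) ->
  mu.-integrable P (EFin \o (fun x => q x * b x)).
Proof.
move=> Iq mb bB.
apply: (@le_integrable _ _ _ mu P mP _ (fun x => B%:E * (EFin \o q) x)%E).
- have /measurable_int/measurable_EFinP mq := Iq.
  by apply/measurable_EFinP; apply: measurable_funM => //; exact: measurable_funTS.
- move=> x _; rewrite /= lee_fin !normrM mulrC ler_wpM2r//.
  by rewrite (le_trans (bB x))// ler_norm.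
- exact: integrableZl.
Qed.

Section transform.
Variables (q : R -> R) (k : R * R -> R).
Hypotheses (Iq : mu.-integrable P (EFin \o q)) (mq : measurable_fun setT q).
Hypotheses (mk : measurable_fun setT k) (k1 : forall z, `|k z| <= 1).

Lemma measurable_kernel_l x : measurable_fun setT (fun y => k (x, y)).
Proof. exact: (measurableT_comp mk (measurable_pair1 x)). Qed.

Lemma integrable_kernel x : mu.-integrable P (EFin \o (fun y => q y * k (x, y))).
Proof.
apply: (@integrable_mul_bounded _ _ 1) => //.
exact: measurable_kernel_l.
Qed.

Lemma measurable_transform :
  measurable_fun setT (fun x => \int[mu]_(y in P) (q y * k (x, y))).
Proof.
apply: (@measurable_Rintegral_parameter _ _ (measurableTypeR R) (measurableTypeR R)
  R mu P mP (fun z => q z.2 * k z)).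
apply: measurable_funM => //.
exact: (measurableT_comp mq measurable_snd).
Qed.

Lemma transform_bounded x :
  `|\int[mu]_(y in P) (q y * k (x, y))| <= \int[mu]_(y in P) `|q y|.
Proof.
apply: (le_trans (le_normr_Rintegral mP (integrable_kernel x))).
apply: le_Rintegral => //.
- exact: (integrable_norm (integrable_kernel x)).
- exact: (integrable_norm Iq).
- by move=> y _; rewrite normrM ler_piMr.
Qed.

End transform.

(** A bounded kernel against two integrable functions is integrable on the
    product, so the bilinear form can be computed in either order. *)
Lemma kernel_fubini p q k :
  mu.-integrable P (EFin \o p) -> measurable_fun setT p ->
  mu.-integrable P (EFin \o q) -> measurable_fun setT q ->
  measurable_fun setT k -> (forall z, `|k z| <= 1) ->
  \int[mu]_(x in P) (p x * \int[mu]_(y in P) (q y * k (x, y))) =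
  \int[mu]_(y in P) (q y * \int[mu]_(x in P) (p x * k (x, y))).
Proof.
move=> Ip mp Iq mq mk k1.
pose F z : \bar R := (p z.1 * q z.2 * k z)%:E.
have mF : measurable_fun setT F.
  apply/measurable_EFinP; apply: measurable_funM => //; apply: measurable_funM.
    exact: (measurableT_comp mp measurable_fst).
  exact: (measurableT_comp mq measurable_snd).
have Q : (\int[mu]_(y in P) `|(q y)%:E| < +oo)%E by have /integrableP[] := Iq.
have Pp : (\int[mu]_(x in P) `|(p x)%:E| < +oo)%E by have /integrableP[] := Ip.
have mnq : measurable_fun setT (fun y => `|(q y)%:E|%E).
  by apply: measurableT_comp => //; exact/measurable_EFinP.
have mnp : measurable_fun setT (fun y => `|(p y)%:E|%E).
  by apply: measurableT_comp => //; exact/measurable_EFinP.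
have IF : (mu \x mu)%E.-integrable (P `*` P) F.
  apply: (@integrable_setX _ _ (measurableTypeR R) (measurableTypeR R)) => //.
    exact: measurable_funTS.
  apply: (@le_lt_trans _ _ (\int[mu]_(x in P) (`|(p x)%:E| *
      \int[mu]_(y in P) `|(q y)%:E|))%E).
    apply: ge0_le_integral => //.
    - by move=> x _; exact: integral_ge0.
    - apply: measurable_funTS.
      apply: (@measurable_ge0_integral_parameter _ _ (measurableTypeR R)
        (measurableTypeR R) R mu P mP (abse \o F)) => //.
        exact: measurableT_comp.
      by move=> z; exact: abse_ge0.
    - by apply: measurable_funTS; apply: emeasurable_funM.
    move=> x _; rewrite -ge0_integralZl//; last exact: measurable_funTS.
    apply: ge0_le_integral => //.
    - apply: measurable_funTS.
      apply: (measurableT_comp (f := abse)) => //.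
      exact: (measurableT_comp mF (measurable_pair1 x)).
    - by apply: measurable_funTS; apply: emeasurable_funM.
    by move=> y _; rewrite /F/= lee_fin !normrM ler_piMr// mulr_ge0.
  rewrite ge0_integralZr//; last 2 first.
  - exact: measurable_funTS.
  - exact: integral_ge0.
  rewrite lte_mul_pinfty//; first exact: integral_ge0.
  by rewrite ge0_fin_numE//; exact: integral_ge0.
have E1 x : (\int[mu]_(y in P) F (x, y))%E =
    (p x * \int[mu]_(y in P) (q y * k (x, y)))%:E.
  rewrite -RintegralZl//; last exact: integrable_kernel.
  rewrite /Rintegral fineK; last first.
    apply: integrable_fin_num => //.
    under [X in mu.-integrable _ X]eq_fun do rewrite EFinM.
    by apply: integrableZl => //; exact: integrable_kernel.
  by apply: eq_integral => y _; rewrite /F/= mulrA.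
pose k' z := k (z.2, z.1).
have mk' : measurable_fun setT k'.
  apply: (measurableT_comp mk).
  exact: (measurable_fun_pair measurable_snd measurable_fst).
have k'1 z : `|k' z| <= 1 by exact: k1.
have E2 y : (\int[mu]_(x in P) F (x, y))%E =
    (q y * \int[mu]_(x in P) (p x * k (x, y)))%:E.
  have Ik := @integrable_kernel p k' Ip mk' k'1 y.
  rewrite -RintegralZl//.
  rewrite /Rintegral fineK; last first.
    apply: integrable_fin_num => //.
    under [X in mu.-integrable _ X]eq_fun do rewrite EFinM.
    exact: integrableZl.
  by apply: eq_integral => x _; rewrite /F/= mulrA (mulrC (q y)).
rewrite /Rintegral; congr fine.
under eq_integral do rewrite -E1.
under [RHS]eq_integral do rewrite -E2.
exact: (fubini_setX mP mP IF).
Qed.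

End bounded_kernel.

(** * The quadratic form of the sine transform on a pair of rays *)

Section ray.
Context {R : realType}.
Local Notation mu := (@lebesgue_measure R).
Local Notation P := (`]0%R, +oo[%classic : set R).

Let mP : measurable (P : set (measurableTypeR R)). Proof. exact: measurable_itv. Qed.

Variables (s al ga : R).
Hypotheses (s0 : 0 < s) (al0 : 0 < al) (ga0 : 0 < ga).

Let K (z : R * R) : R := sin (ga * z.1 * z.2).

Let KC u v : K (u, v) = K (v, u).
Proof. by rewrite /K/= mulrAC. Qed.

Let K1 z : `|K z| <= 1. Proof. exact: sin_max. Qed.

Let mK : measurable_fun setT K.
Proof.
have ms : measurable_fun setT (@sin R).
  by apply: continuous_measurable_fun; exact: continuous_sin.
apply: (measurableT_comp ms).
by apply: measurable_funM => //; exact: measurable_funM.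
Qed.

Let mKl u : measurable_fun setT (fun v => K (u, v)).
Proof. exact: measurable_kernel_l. Qed.

(** The product of sines is half the difference of two cosines, and the cosine
    transform of [gauss s] is an even Gaussian: its value at [ga * (u - u')] is at
    least the one at [ga * (u + u')]. *)
Lemma gauss_sin_sin_ge0 (u u' : R) : 0 < u -> 0 < u' ->
  0 <= \int[mu]_(v in P) (gauss s v * sin (ga * u * v) * sin (ga * v * u')).
Proof.
move=> u0 u'0.
have -> : \int[mu]_(v in P) (gauss s v * sin (ga * u * v) * sin (ga * v * u')) =
   2^-1 * (gauss_cos s (ga * (u - u')) - gauss_cos s (ga * (u + u'))).
  have Ic t : mu.-integrable P (EFin \o (fun u => gauss s u * cos (t * u))).
    apply: integrable_gauss => //; first exact: measurable_mul_cos.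
    by move=> x; exact: cos_max.
  rewrite /gauss_cos -RintegralB// -RintegralZl//; last first.
    under [_ \o _]eq_fun do rewrite /= EFinB.
    by apply: integrableB => //; exact: Ic.
  apply: eq_Rintegral => v _.
  rewrite (_ : ga * (u - u') * v = ga * u * v - ga * v * u'); last by ring.
  rewrite (_ : ga * (u + u') * v = ga * u * v + ga * v * u'); last by ring.
  by rewrite cosB cosD; field.
rewrite mulr_ge0// !gauss_cosE// -mulrBr mulr_ge0 ?sqrtr_ge0//.
rewrite subr_ge0 /gauss ler_expR lerN2 ler_pM2r ?invr_gt0// ler_pM2l ?invr_gt0//.
rewrite !exprMn ler_pM2l ?exprn_gt0//.
by rewrite sqrrB sqrrD; nra.
Qed.

Let p1 (u : R) : R := u * gauss al u.

Let mp1 : measurable_fun setT p1.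
Proof. by apply: measurable_funM => //; exact: measurable_gauss. Qed.

Let Ip1 : mu.-integrable P (EFin \o p1).
Proof.
have := @integrable_mul_gauss R al (cst 1) al0 (measurable_cst _).
move=> /(_ (fun=> _)) H; apply: eq_integrable (H _) => //.
  by move=> u _ /=; rewrite mulr1.
by move=> u; rewrite /= normr1.
Qed.

Let p1_ge0 u : 0 < u -> 0 <= p1 u.
Proof. by move=> u0; rewrite mulr_ge0 ?gauss_ge0// ltW. Qed.

Let Ig : mu.-integrable P (EFin \o gauss s).
Proof.
have := @integrable_gauss R s (cst 1) s0 (measurable_cst _).
move=> /(_ (fun=> _)) H; apply: eq_integrable (H _) => //.
  by move=> u _ /=; rewrite mulr1.
by move=> u; rewrite /= normr1.
Qed.

Definition sine_transform (p : R -> R) v := \int[mu]_(u in P) (p u * sin (ga * v * u)).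

Section dominated.
Variable p : R -> R.
Hypotheses (mp : measurable_fun setT p) (pp1 : forall u, 0 < u -> `|p u| <= p1 u).

Let Ip : mu.-integrable P (EFin \o p).
Proof.
apply: (@le_integrable _ _ _ mu P mP _ (EFin \o p1)) => //.
  by apply/measurable_EFinP; exact: measurable_funTS.
move=> u; rewrite /= in_itv/= andbT lee_fin => u0.
by rewrite (le_trans (pp1 u0))// ler_norm.
Qed.

Let T := sine_transform p.

Let B := \int[mu]_(u in P) `|p u|.

Lemma measurable_sine_transform : measurable_fun setT T.
Proof. exact: (@measurable_transform _ p K). Qed.
Let mT := measurable_sine_transform.

Lemma sine_transform_bounded v : `|T v| <= B.
Proof. exact: (@transform_bounded _ p K). Qed.
Let TB := sine_transform_bounded.

Let q v := gauss s v * T v.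

Let mq : measurable_fun setT q.
Proof. by apply: measurable_funM => //; exact: measurable_gauss. Qed.

Let Iq : mu.-integrable P (EFin \o q).
Proof. exact: (integrable_mul_bounded Ig mT TB). Qed.

Lemma integrable_gauss_sqr_transform :
  mu.-integrable P (EFin \o (fun v => gauss s v * T v ^+ 2)).
Proof.
apply: eq_integrable (integrable_mul_bounded Iq mT TB) => //.
by move=> v _ /=; rewrite /q -mulrA expr2.
Qed.

(** The gradient at [p] of the quadratic form
    [int gauss s v * (sine_transform p v)^2 dv], up to a factor 2. *)
Definition second_transform u := \int[mu]_(v in P) (q v * K (u, v)).

Lemma sqr_transformE : \int[mu]_(v in P) (gauss s v * T v ^+ 2) =
  \int[mu]_(u in P) (p u * second_transform u).
Proof.
rewrite /second_transform kernel_fubini//.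
apply: eq_Rintegral => v _; rewrite /q -mulrA expr2; congr (_ * (_ * _)).
by apply: eq_Rintegral => u _; rewrite KC.
Qed.

(** The kernel of the quadratic form is the one of [gauss_sin_sin_ge0]. *)
Lemma second_transformE u : second_transform u =
  \int[mu]_(u' in P) (p u' *
    \int[mu]_(v in P) (gauss s v * sin (ga * u * v) * sin (ga * v * u'))).
Proof.
rewrite /second_transform.
transitivity (\int[mu]_(v in P) (gauss s v * K (u, v) *
    \int[mu]_(u' in P) (p u' * K (v, u')))).
  by apply: eq_Rintegral => v _; rewrite /q mulrAC.
rewrite kernel_fubini//.
- exact: integrable_mul_bounded.
- by apply: measurable_funM => //; exact: measurable_gauss.
Qed.

Lemma integrable_second_transform :
  mu.-integrable P (EFin \o (fun u => p u * second_transform u)).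
Proof.
apply: (integrable_mul_bounded Ip (measurable_transform mq mK)).
exact: transform_bounded.
Qed.

Lemma integrable_kernel_M u :
  mu.-integrable P (EFin \o (fun u' => p u' *
    \int[mu]_(v in P) (gauss s v * sin (ga * u * v) * sin (ga * v * u')))).
Proof.
have mgK : measurable_fun setT (fun v => gauss s v * K (u, v)).
  by apply: measurable_funM => //; exact: measurable_gauss.
have IgK : mu.-integrable P (EFin \o (fun v => gauss s v * K (u, v))).
  exact: integrable_mul_bounded.
apply: (@integrable_mul_bounded _ _ _
  (\int[mu]_(v in P) `|gauss s v * K (u, v)|)) => //.
  have := @measurable_transform _ _ _ mgK mK.
  congr (measurable_fun _ _); apply/funext => u'.
  by apply: eq_Rintegral => v _; rewrite (KC u').
move=> u'; have := @transform_bounded _ _ _ IgK mK K1 u'.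
congr (`|_| <= _); by apply: eq_Rintegral => v _; rewrite (KC u').
Qed.

End dominated.

Let p1p1 u : 0 < u -> `|p1 u| <= p1 u.
Proof. by move=> u0; rewrite ger0_norm ?p1_ge0. Qed.

Variable p : R -> R.
Hypotheses (mp : measurable_fun setT p) (pp1 : forall u, 0 < u -> `|p u| <= p1 u).

Let second_transform_le u : 0 < u -> `|second_transform p u| <= second_transform p1 u.
Proof.
move=> u0; rewrite (second_transformE mp pp1) (second_transformE mp1 p1p1).
apply: (le_trans (le_normr_Rintegral _ (integrable_kernel_M mp pp1 u))) => //.
apply: le_Rintegral => //.
- exact: (integrable_norm (integrable_kernel_M mp pp1 u)).
- exact: integrable_kernel_M.
- move=> u'; rewrite /= in_itv/= andbT => u'0.
  rewrite normrM [X in _ * X]ger0_norm ?gauss_sin_sin_ge0//.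
  by rewrite ler_wpM2r ?gauss_sin_sin_ge0// pp1.
Qed.

(** A quadratic form with nonnegative kernel does not decrease when [p] is
    replaced by a majorant of [|p|]. *)
Lemma sqr_sine_transform_le :
  \int[mu]_(v in P) (gauss s v * sine_transform p v ^+ 2) <=
  \int[mu]_(v in P) (gauss s v * sine_transform p1 v ^+ 2).
Proof.
rewrite (sqr_transformE mp pp1) (sqr_transformE mp1 p1p1).
apply: le_Rintegral => //.
- exact: integrable_second_transform.
- exact: integrable_second_transform.
- move=> u; rewrite /= in_itv/= andbT => u0.
  rewrite (le_trans (ler_norm _))// normrM ler_pM//; first exact: pp1.
  exact: second_transform_le.
Qed.

End ray.

(** * The optimal bound on a pair of rays *)

Section ray_bound.
Context {R : realType}.
Local Notation mu := (@lebesgue_measure R).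
Local Notation P := (`]0%R, +oo[%classic : set R).

Let mP : measurable (P : set (measurableTypeR R)). Proof. exact: measurable_itv. Qed.

Variables (al be ga : R).
Hypotheses (al0 : 0 < al) (be0 : 0 < be) (ga0 : 0 < ga).

Let kappa := ga / al * Num.sqrt (pi / (2 * al)).

Let kappa_gt0 : 0 < kappa.
Proof. by rewrite mulr_gt0 ?divr_gt0// sqrtr_gt0 divr_gt0 ?mulr_gt0// pi_gt0. Qed.

Lemma gauss_sin_rayE v :
  gauss_sin al (ga * v) = kappa * (v * gauss (ga ^+ 2 / al) v).
Proof.
have E := gauss_sinE (ga * v) al0.
apply: (@mulfI _ al); first by rewrite gt_eqF.
rewrite E gauss_cosE// (_ : gauss al^-1 (ga * v) = gauss (ga ^+ 2 / al) v).
  by rewrite /kappa; field; rewrite gt_eqF.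
by rewrite /gauss; congr expR; field; rewrite gt_eqF.
Qed.

Lemma gauss_sin_ray_ge0 v : 0 < v -> 0 <= gauss_sin al (ga * v).
Proof.
move=> v0; rewrite gauss_sin_rayE; have := kappa_gt0.
by move=> /ltW k0; rewrite mulr_ge0// mulr_ge0 ?gauss_ge0// ltW.
Qed.

Lemma integral_gauss_sin_ray :
  (\int[mu]_(v in P) (v * gauss be v * gauss_sin al (ga * v))%:E =
   (pi / 2 * ga / ((al * be + ga ^+ 2) * Num.sqrt (al * be + ga ^+ 2)))%:E)%E.
Proof.
pose c := be + ga ^+ 2 / al.
have c0 : 0 < c by rewrite addr_gt0// divr_gt0// exprn_gt0.
have -> : al * be + ga ^+ 2 = al * c by rewrite /c; field; rewrite gt_eqF.
transitivity (\int[mu]_(v in P) (kappa%:E * (v ^+ 2 * gauss c v)%:E))%E.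
  apply: eq_integral => v _; rewrite gauss_sin_rayE gaussD -EFinM.
  by congr EFin; ring.
rewrite ge0_integralZl//; last 3 first.
- apply/measurable_EFinP; apply: measurable_funTS; apply: measurable_funM => //.
  exact: measurable_gauss.
- by move=> v _; rewrite lee_fin mulr_ge0 ?gauss_ge0 ?sqr_ge0.
- by rewrite lee_fin ltW.
rewrite integral_sqr_gauss// -EFinM /kappa; congr EFin.
have sal : 0 <= pi / (2 * al) by rewrite divr_ge0 ?pi_ge0// mulr_ge0// ltW.
have -> : ga / al * Num.sqrt (pi / (2 * al)) * (Num.sqrt (pi / (2 * c)) / c) =
    ga / (al * c) * (Num.sqrt (pi / (2 * al)) * Num.sqrt (pi / (2 * c))).
  by field; rewrite !gt_eqF.
rewrite -sqrtrM//.
have -> : pi / (2 * al) * (pi / (2 * c)) = (pi / 2) ^+ 2 / (al * c).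
  by field; rewrite !gt_eqF.
have alc : 0 < al * c by exact: mulr_gt0.
rewrite sqrtrM ?sqr_ge0// sqrtr_sqr sqrtrV ?(ltW alc)//.
rewrite ger0_norm ?divr_ge0 ?pi_ge0//.
have sq0 : 0 < Num.sqrt (al * c) by rewrite sqrtr_gt0.
by field; rewrite !gt_eqF.
Qed.

Hypothesis al_be_ga : ga ^+ 2 < al * be.
Variable p : R -> R.
Hypotheses (mp : measurable_fun setT p)
  (pp1 : forall u, 0 < u -> `|p u| <= u * gauss al u).

(** The weight [v * gauss be v] is [kappa^-1 * gauss s v * tau v] with
    [tau v = gauss_sin al (ga * v)], so [2 |X| tau <= X^2 + tau^2] reduces the claim
    to [sqr_sine_transform_le].  Choosing the weight proportional to [tau] makes
    the two halves of the bound equal for the largest input. *)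
Lemma ray_bound :
  (\int[mu]_(v in P) (v * gauss be v * `|sine_transform ga p v|)%:E <=
   \int[mu]_(v in P) (v * gauss be v * gauss_sin al (ga * v))%:E)%E.
Proof.
pose s := be - ga ^+ 2 / al.
have s0 : 0 < s by rewrite subr_gt0 ltr_pdivrMr// mulrC.
pose p1 (u : R) : R := u * gauss al u.
have mp1 : measurable_fun setT p1.
  by apply: measurable_funM => //; exact: measurable_gauss.
have p1p1 u : 0 < u -> `|p1 u| <= p1 u.
  by move=> u0; rewrite ger0_norm// mulr_ge0 ?gauss_ge0// ltW.
pose X := sine_transform ga p.
pose tau v := gauss_sin al (ga * v).
have mX : measurable_fun setT X by exact: (measurable_sine_transform ga mp).
have IX : mu.-integrable P (EFin \o (fun v => gauss s v * X v ^+ 2)).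
  exact: (integrable_gauss_sqr_transform ga s0 al0 mp pp1).
have It : mu.-integrable P (EFin \o (fun v => gauss s v * tau v ^+ 2)).
  exact: (integrable_gauss_sqr_transform ga s0 al0 mp1 p1p1).
have le2 : \int[mu]_(v in P) (gauss s v * X v ^+ 2) <=
    \int[mu]_(v in P) (gauss s v * tau v ^+ 2).
  exact: (sqr_sine_transform_le s0 al0 ga0 mp pp1).
have wE v : v * gauss be v = kappa^-1 * (gauss s v * tau v).
  rewrite /tau gauss_sin_rayE (_ : be = s + ga ^+ 2 / al); last by rewrite subrK.
  by rewrite gaussD; field; rewrite !gt_eqF.
have EX : (\int[mu]_(v in P) (gauss s v * X v ^+ 2)%:E =
    (\int[mu]_(v in P) (gauss s v * X v ^+ 2))%:E)%E.
  by rewrite /Rintegral fineK//; exact: integrable_fin_num.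
have Et : (\int[mu]_(v in P) (gauss s v * tau v ^+ 2)%:E =
    (\int[mu]_(v in P) (gauss s v * tau v ^+ 2))%:E)%E.
  by rewrite /Rintegral fineK//; exact: integrable_fin_num.
have mIX := measurable_int _ IX; have mIt := measurable_int _ It.
have g2 (f : R -> R) v : P v -> (0 <= (gauss s v * f v ^+ 2)%:E)%E.
  by move=> _; rewrite lee_fin mulr_ge0 ?gauss_ge0 ?sqr_ge0.
have k0 : 0 <= kappa^-1 by rewrite invr_ge0 ltW.
have k20 : 0 <= kappa^-1 / 2 by rewrite divr_ge0.
apply: (@le_trans _ _ (\int[mu]_(v in P) ((kappa^-1 / 2)%:E *
    ((gauss s v * X v ^+ 2)%:E + (gauss s v * tau v ^+ 2)%:E)))%E).
  apply: ge0_le_integral => //.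
  - move=> v; rewrite /= in_itv/= andbT => v0.
    by rewrite lee_fin mulr_ge0 ?mulr_ge0 ?gauss_ge0// ltW.
  - apply/measurable_EFinP/measurable_funTS; apply: measurable_funM.
      by apply: measurable_funM => //; exact: measurable_gauss.
    exact: measurableT_comp.
  - by apply: emeasurable_funM => //; exact: emeasurable_funD.
  - move=> v; rewrite /= in_itv/= andbT => v0.
    rewrite -EFinD -EFinM lee_fin wE.
    have t0 := gauss_sin_ray_ge0 v0.
    have := mulr_ge0 (mulr_ge0 k20 (gauss_ge0 s v)) (sqr_ge0 (`|X v| - tau v)).
    rewrite sqrrB -normrX (ger0_norm (sqr_ge0 (X v))) -/X.
    move: (`|X v|) => x; move: (X v ^+ 2) (tau v) (gauss s v) kappa^-1.
    move=> a b c d H; rewrite -subr_ge0; apply: (le_trans H).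
    by rewrite le_eqVlt; apply/orP; left; apply/eqP; field.
rewrite ge0_integralZl//; last 2 first.
- exact: emeasurable_funD.
- by move=> v Pv; rewrite adde_ge0 ?g2.
rewrite ge0_integralD//; [|exact: g2|exact: g2].
have -> : (\int[mu]_(v in P) (v * gauss be v * gauss_sin al (ga * v))%:E =
    \int[mu]_(v in P) ((kappa^-1)%:E * (gauss s v * tau v ^+ 2)%:E))%E.
  apply: eq_integral => v _; rewrite wE -EFinM -/(tau v).
  by congr EFin; ring.
rewrite ge0_integralZl//; last exact: g2.
rewrite EX Et -EFinD -!EFinM lee_fin.
move: le2; set A := Rintegral _ _ _; set B := Rintegral _ _ _ => AB.
by rewrite -mulrA ler_wpM2l// ler_pdivrMl//; lra.
Qed.

End ray_bound.

(** * Integration over the slopes *)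

Section explicit_integrals.
Context {R : realType}.
Local Notation mu := (@lebesgue_measure R).
Local Notation P := (`]0%R, +oo[%classic : set R).
Implicit Types a b : R.

Lemma ge0_integral_halfline_derive (F f : R -> R) (l : R) :
  continuous f -> (forall x, 0 <= x -> 0 <= f x) ->
  (forall x : R, is_derive x 1 F (f x)) -> F x @[x --> +oo] --> l ->
  (\int[mu]_(x in P) (f x)%:E = (l - F 0)%:E)%E.
Proof.
move=> cf f0 dF Fl.
rewrite integral_itv_obnd_cbnd; last first.
  by apply/measurable_EFinP/measurable_funTS; exact: continuous_measurable_fun.
rewrite (@ge0_continuous_FTC2y R f F 0 l) ?EFinB//.
- exact: continuous_subspaceT.
- apply: cvg_at_right_filter; apply: differentiable_continuous.
  by apply/derivable1_diffP; have [] := dF 0.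
- by move=> x _; rewrite derive1E; have [_] := dF x.
Qed.

Lemma cvg_pinfty_inv (G : R -> R) : {for 0, continuous G} ->
  G x^-1 @[x --> +oo] --> G 0.
Proof.
move=> cG; apply: continuous_cvg => //.
apply/(gtr0_cvgV0 (f := id)); last exact: cvg_id.
by near=> x; near: x; exact: nbhs_pinfty_gt.
Unshelve. all: end_near. Qed.

Lemma is_derive_quadratic (c2 c1 c0 x : R) :
  is_derive x 1 (fun y => c2 * y ^+ 2 + c1 * y + c0) (2 * c2 * x + c1).
Proof.
have I := @is_derive_id R R x 1.
have -> : (fun y => c2 * y ^+ 2 + c1 * y + c0) =
    c2 *: (id * id) + c1 *: id + cst c0.
  by apply/funext => y; rewrite !fctE /GRing.scale/= expr2.
have := is_deriveD (is_deriveD (is_deriveZ c2 (is_deriveM I I))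
  (is_deriveZ c1 I)) (is_derive_cst c0 x 1).
by move/is_derive_eq; apply; rewrite /GRing.scale/=; ring.
Qed.

Definition dir_det a b : R := (1 + a ^+ 2) * (1 + b ^+ 2) + (1 + a * b) ^+ 2.

Lemma dir_det_gt0 a b : 0 < dir_det a b.
Proof.
rewrite ltr_wpDr ?sqr_ge0// mulr_gt0// ltr_pwDl//; exact: sqr_ge0.
Qed.

(** The integral of [integral_gauss_sin_ray] divided by [pi / 2], for the rays of
    slopes [a] and [b]. *)
Definition dir_weight a b : R :=
  (1 + a * b) / (dir_det a b * Num.sqrt (dir_det a b)).

Lemma dir_det_polyE b a :
  dir_det a b = (1 + 2 * b ^+ 2) * a ^+ 2 + 2 * b * a + (2 + b ^+ 2).
Proof. by rewrite /dir_det; ring. Qed.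

Lemma dir_weight_ge0 a b : 0 <= a -> 0 <= b -> 0 <= dir_weight a b.
Proof.
move=> a0 b0; rewrite divr_ge0 ?addr_ge0 ?mulr_ge0 ?sqrtr_ge0//.
exact: ltW (dir_det_gt0 _ _).
Qed.

Lemma is_derive_dir_det b a :
  is_derive a 1 (dir_det ^~ b) (2 * ((1 + 2 * b ^+ 2) * a + b)).
Proof.
rewrite (_ : dir_det ^~ b = fun y : R => (1 + 2 * b ^+ 2) * y ^+ 2 + 2 * b * y
    + (2 + b ^+ 2)); last by apply/funext => y; rewrite dir_det_polyE.
apply: (is_derive_eq (is_derive_quadratic _ _ _ a)); ring.
Qed.

Lemma continuous_dir_det b : continuous (dir_det ^~ b).
Proof.
move=> a; apply: differentiable_continuous; apply/derivable1_diffP.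
by have [] := is_derive_dir_det b a.
Qed.

Lemma continuous_dir_weight b : continuous (dir_weight ^~ b).
Proof.
move=> a; apply: cvgM.
  by apply: cvgD; [exact: cvg_cst|apply: cvgMl; exact: cvg_id].
apply: cvgV.
  by rewrite mulf_neq0 ?gt_eqF ?sqrtr_gt0 ?dir_det_gt0.
apply: cvgM; first exact: continuous_dir_det.
apply: continuous_comp; first exact: continuous_dir_det.
exact: sqrt_continuous.
Qed.

Definition dir_primitive b a : R :=
  (a - b) / (2 * (1 + b ^+ 2) * Num.sqrt (dir_det a b)).

Lemma is_derive_dir_primitive b a :
  is_derive a 1 (dir_primitive b) (dir_weight a b).
Proof.
have D0 := dir_det_gt0 a b; have sD0 : 0 < Num.sqrt (dir_det a b).
  by rewrite sqrtr_gt0.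
have E1 := is_derive_dir_det b a.
have E2 : is_derive a 1 (fun x => Num.sqrt (dir_det x b))
    ((2 * Num.sqrt (dir_det a b))^-1 * (2 * ((1 + 2 * b ^+ 2) * a + b))).
  by have F := is_derive1_sqrt D0; exact: (@is_derive1_comp _ Num.sqrt (dir_det ^~ b) a _ _ F E1).
have E3 : is_derive a 1 (fun x => (Num.sqrt (dir_det x b))^-1)
    (- Num.sqrt (dir_det a b) ^- 2 *: ((2 * Num.sqrt (dir_det a b))^-1 *
      (2 * ((1 + 2 * b ^+ 2) * a + b)))).
  by apply: is_deriveV; rewrite gt_eqF.
have b1 : 0 < 1 + b ^+ 2 by rewrite ltr_pwDl// sqr_ge0.
rewrite (_ : dir_primitive b = (2 * (1 + b ^+ 2))^-1 *:
    ((id - cst b) * (fun x => (Num.sqrt (dir_det x b))^-1))); last first.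
  apply/funext => x; rewrite /dir_primitive !fctE /GRing.scale/=.
  by rewrite invfM mulrCA.
apply: is_derive_eq; rewrite /GRing.scale/= /dir_weight !fctE.
have sq : Num.sqrt (dir_det a b) ^+ 2 = dir_det a b by rewrite sqr_sqrtr// ltW.
have := dir_det_polyE b a.
move: (Num.sqrt _) sD0 sq => r r0 <- rE.
(* the numerator of the derivative, where r^2 = dir_det a b *)
have r2 : r ^+ 2 - (a - b) * ((1 + 2 * b ^+ 2) * a + b) =
    2 * (1 + b ^+ 2) * (1 + a * b) by rewrite rE; ring.
apply: (@mulIf _ (2 * (1 + b ^+ 2) * r ^+ 3)).
  by rewrite !mulf_neq0 ?expf_neq0 ?gt_eqF.
transitivity (r ^+ 2 - (a - b) * ((1 + 2 * b ^+ 2) * a + b)).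
  by field; rewrite !gt_eqF.
by rewrite r2; field; rewrite gt_eqF.
Qed.

(** With [z = 1 / a], numerator and denominator divided by [a] are continuous
    at [z = 0]. *)
Lemma cvg_dir_primitive b : dir_primitive b a @[a --> +oo] -->
  (2 * (1 + b ^+ 2) * Num.sqrt (1 + 2 * b ^+ 2))^-1.
Proof.
pose D z := (1 + 2 * b ^+ 2) + 2 * b * z + (2 + b ^+ 2) * z ^+ 2.
pose G z := (1 - b * z) / (2 * (1 + b ^+ 2) * Num.sqrt (D z)).
have b1 : 0 < 1 + b ^+ 2 by rewrite ltr_pwDl// sqr_ge0.
have b2 : 0 < 1 + 2 * b ^+ 2 by rewrite ltr_pwDl// mulr_ge0// sqr_ge0.
have D0 : D 0 = 1 + 2 * b ^+ 2 by rewrite /D expr0n !mulr0 !addr0.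
have G0 : G 0 = (2 * (1 + b ^+ 2) * Num.sqrt (1 + 2 * b ^+ 2))^-1.
  by rewrite /G D0 mulr0 subr0 mul1r.
rewrite -G0.
have cG : {for 0, continuous G}.
  apply: cvgM; first by apply: cvgB; [exact: cvg_cst|exact: mulrl_continuous].
  apply: cvgV.
    by rewrite D0 !mulf_neq0 ?gt_eqF// sqrtr_gt0.
  apply: cvgMr; apply: continuous_comp; last exact: sqrt_continuous.
  apply: cvgD.
    by apply: cvgD; [exact: cvg_cst|exact: mulrl_continuous].
  by apply: cvgMr; exact: exprn_continuous.
apply: cvg_trans (cvg_pinfty_inv cG).
apply: near_eq_cvg; near=> a.
have a0 : 0 < a by near: a; exact: nbhs_pinfty_gt.
rewrite /G /dir_primitive.
have -> : dir_det a b = a ^+ 2 * D a^-1.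
  by rewrite dir_det_polyE /D; field; rewrite gt_eqF.
rewrite sqrtrM ?sqr_ge0// sqrtr_sqr gtr0_norm//.
have Da : 0 < D a^-1.
  have := dir_det_gt0 a b.
  rewrite (_ : dir_det a b = a ^+ 2 * D a^-1); last first.
    by rewrite dir_det_polyE /D; field; rewrite gt_eqF.
  by rewrite pmulr_rgt0// exprn_gt0.
have : 0 < Num.sqrt (D a^-1) by rewrite sqrtr_gt0.
by move=> ?; field; rewrite !gt_eqF.
Unshelve. all: end_near. Qed.

Definition dir_marginal b : R :=
  (1 / Num.sqrt (1 + 2 * b ^+ 2) + b / Num.sqrt (2 + b ^+ 2)) /
  (2 * (1 + b ^+ 2)).

Lemma integral_dir_weight b : 0 <= b ->
  (\int[mu]_(a in P) (dir_weight a b)%:E = (dir_marginal b)%:E)%E.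
Proof.
move=> b0.
rewrite (@ge0_integral_halfline_derive _ _ _ (@continuous_dir_weight b) _
  (is_derive_dir_primitive b) (@cvg_dir_primitive b)).
  congr EFin; rewrite /dir_primitive /dir_marginal /dir_det.
  rewrite expr0n !mul0r !addr0 mul1r expr1n (_ : 1 + b ^+ 2 + 1 = 2 + b ^+ 2); last by ring.
  have b1 : 0 < 1 + b ^+ 2 by rewrite ltr_pwDl// sqr_ge0.
  have s1 : 0 < Num.sqrt (1 + 2 * b ^+ 2).
    by rewrite sqrtr_gt0 ltr_pwDl// mulr_ge0// sqr_ge0.
  have s2 : 0 < Num.sqrt (2 + b ^+ 2) by rewrite sqrtr_gt0 ltr_pwDl// sqr_ge0.
  by field; rewrite !gt_eqF.
by move=> a a0; exact: dir_weight_ge0.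
Qed.

Let p b : R := Num.sqrt (1 + 2 * b ^+ 2).
Let q b : R := Num.sqrt (2 + b ^+ 2).

Let psq b : p b ^+ 2 = 1 + 2 * b ^+ 2.
Proof. by rewrite sqr_sqrtr// addr_ge0// mulr_ge0// sqr_ge0. Qed.

Let qsq b : q b ^+ 2 = 2 + b ^+ 2.
Proof. by rewrite sqr_sqrtr// addr_ge0// sqr_ge0. Qed.

Let p_gt0 b : 0 < p b.
Proof. by rewrite sqrtr_gt0 ltr_pwDl// mulr_ge0// sqr_ge0. Qed.

Let q_gt0 b : 0 < q b.
Proof. by rewrite sqrtr_gt0 ltr_pwDl// sqr_ge0. Qed.

Let pb_gt0 b : 0 < p b + b.
Proof.
have : `|b| < p b.
  rewrite -(@ltr_pXn2r _ 2) ?nnegrE// ?ltW// psq -normrX ger0_norm ?sqr_ge0//.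
  by have := sqr_ge0 b; lra.
by have := ler_norm (- b); rewrite normrN; lra.
Qed.

Let dp b : is_derive b 1 p (2 * b / p b).
Proof.
have E : is_derive b 1 (fun x => 1 + 2 * x ^+ 2) (4 * b).
  rewrite (_ : (fun x => _) = fun y : R => 2 * y ^+ 2 + 0 * y + 1); last first.
    by apply/funext => y; ring.
  apply: (is_derive_eq (is_derive_quadratic _ _ _ b)); ring.
have F : is_derive (1 + 2 * b ^+ 2) 1 Num.sqrt (2 * Num.sqrt (1 + 2 * b ^+ 2))^-1.
  by apply: is_derive1_sqrt; rewrite ltr_pwDl// mulr_ge0// sqr_ge0.
have := @is_derive1_comp _ Num.sqrt (fun x => 1 + 2 * x ^+ 2) b _ _ F E.
rewrite -/(p b).
have -> : (2 * p b)^-1 * (4 * b) = 2 * b / p b by field; rewrite gt_eqF.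
exact.
Qed.

Let dq b : is_derive b 1 q (b / q b).
Proof.
have E : is_derive b 1 (fun x => 2 + x ^+ 2) (2 * b).
  rewrite (_ : (fun x => _) = fun y : R => 1 * y ^+ 2 + 0 * y + 2); last first.
    by apply/funext => y; ring.
  apply: (is_derive_eq (is_derive_quadratic _ _ _ b)); ring.
have F : is_derive (2 + b ^+ 2) 1 Num.sqrt (2 * Num.sqrt (2 + b ^+ 2))^-1.
  by apply: is_derive1_sqrt; rewrite ltr_pwDl// sqr_ge0.
have := @is_derive1_comp _ Num.sqrt (fun x => 2 + x ^+ 2) b _ _ F E.
rewrite -/(q b).
have -> : (2 * q b)^-1 * (2 * b) = b / q b by field; rewrite gt_eqF.
exact.
Qed.

Let cp : continuous p.
Proof.
move=> b; apply: differentiable_continuous; apply/derivable1_diffP.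
by have [] := dp b.
Qed.

Let cq : continuous q.
Proof.
move=> b; apply: differentiable_continuous; apply/derivable1_diffP.
by have [] := dq b.
Qed.

(* The two terms of [dir_marginal] have primitives involving artanh (b / p) and
   artanh (1 / q).  As p^2 - b^2 = q^2 - 1 = 1 + b^2, their logarithms of
   1 + b^2 cancel and [Phi] is what remains. *)
Let Phi b : R := 2^-1 * (ln (p b + b) - ln (q b + 1)).

Let dPhi b : is_derive b 1 Phi (dir_marginal b).
Proof.
have E1 : is_derive b 1 (fun x => p x + x) (2 * b / p b + 1).
  exact: (is_deriveD (dp b) (is_derive_id b 1)).
have E2 : is_derive b 1 (fun x => q x + 1) (b / q b).
  apply: (is_derive_eq (is_deriveD (dq b) (is_derive_cst (1 : R) b 1))).
  exact: addr0.
have q1 : 0 < q b + 1 by rewrite ltr_wpDr.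
have L1 : is_derive b 1 (fun x => ln (p x + x)) ((p b + b)^-1 * (2 * b / p b + 1)).
  have F := is_derive1_ln (pb_gt0 b).
  exact: (@is_derive1_comp _ (@ln R) (fun x => p x + x) b _ _ F E1).
have L2 : is_derive b 1 (fun x => ln (q x + 1)) ((q b + 1)^-1 * (b / q b)).
  have F := is_derive1_ln q1.
  exact: (@is_derive1_comp _ (@ln R) (fun x => q x + 1) b _ _ F E2).
rewrite (_ : Phi = 2^-1 *: ((fun x => ln (p x + x)) - (fun x => ln (q x + 1))))//.
apply: is_derive_eq; rewrite /GRing.scale/= /dir_marginal -/(p b) -/(q b).
have b1 : 0 < 1 + b ^+ 2 by rewrite ltr_pwDl// sqr_ge0.
have := psq b; have := qsq b; have := p_gt0 b; have := q_gt0 b.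
have := pb_gt0 b; move: q1.
move: (p b) (q b) => r t t1 rb t0 r0 tE rE.
have -> : (r + b)^-1 = (r - b) / (1 + b ^+ 2).
  apply: (@mulIf _ (r + b)); first by rewrite gt_eqF.
  rewrite mulVf ?gt_eqF//.
  apply: (@mulIf _ (1 + b ^+ 2)); first by rewrite gt_eqF.
  rewrite mul1r mulrAC divfK ?gt_eqF//.
  by transitivity (r ^+ 2 - b ^+ 2); [rewrite rE|]; ring.
have -> : (t + 1)^-1 = (t - 1) / (1 + b ^+ 2).
  apply: (@mulIf _ (t + 1)); first by rewrite gt_eqF.
  rewrite mulVf ?gt_eqF//.
  apply: (@mulIf _ (1 + b ^+ 2)); first by rewrite gt_eqF.
  rewrite mul1r mulrAC divfK ?gt_eqF//.
  by transitivity (t ^+ 2 - 1); [rewrite tE|]; ring.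
apply: (@mulIf _ (2 * (1 + b ^+ 2) * r * t)).
  by rewrite !mulf_neq0 ?gt_eqF.
transitivity (t * (r ^+ 2 - 2 * b ^+ 2 + b * r) - r * (b * t - b)).
  by field; rewrite !gt_eqF.
by rewrite rE; field; rewrite !gt_eqF.
Qed.

Let cPhi : Phi b @[b --> +oo] --> 2^-1 * ln (1 + Num.sqrt 2 : R).
Proof.
pose G (z : R) := 2^-1 * (ln (Num.sqrt (z ^+ 2 + 2) + 1) - ln (Num.sqrt (2 * z ^+ 2 + 1) + z)).
have G0 : G 0 = 2^-1 * ln (1 + Num.sqrt 2).
  by rewrite /G expr0n mulr0 !add0r sqrtr1 addr0 ln1 subr0 addrC.
rewrite -G0.
have cG : {for 0, continuous G}.
  apply: cvgMr; apply: cvgB.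
    apply: continuous_comp; last first.
      by apply: continuous_ln; rewrite ltr_wpDl ?sqrtr_ge0.
    apply: cvgD; last exact: cvg_cst.
    apply: continuous_comp; last exact: sqrt_continuous.
    by apply: cvgD; [exact: exprn_continuous|exact: cvg_cst].
  apply: continuous_comp; last first.
    by apply: continuous_ln; rewrite expr0n mulr0 add0r sqrtr1 addr0.
  apply: cvgD; last exact: cvg_id.
  apply: continuous_comp; last exact: sqrt_continuous.
  apply: cvgD; last exact: cvg_cst.
  by apply: cvgMr; exact: exprn_continuous.
apply: cvg_trans (cvg_pinfty_inv cG).
apply: near_eq_cvg; near=> b.
have b0 : 0 < b by near: b; exact: nbhs_pinfty_gt.
rewrite /G /Phi; congr (2^-1 * _).
have pE : p b + b = b * (Num.sqrt (b^-1 ^+ 2 + 2) + 1).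
  rewrite mulrDr mulr1; congr (_ + _).
  rewrite /p (_ : 1 + 2 * b ^+ 2 = b ^+ 2 * (b^-1 ^+ 2 + 2)); last first.
    by field; rewrite gt_eqF.
  by rewrite sqrtrM ?sqr_ge0// sqrtr_sqr gtr0_norm.
have qE : q b + 1 = b * (Num.sqrt (2 * b^-1 ^+ 2 + 1) + b^-1).
  rewrite mulrDr divff ?gt_eqF//; congr (_ + _).
  rewrite /q (_ : 2 + b ^+ 2 = b ^+ 2 * (2 * b^-1 ^+ 2 + 1)); last first.
    by field; rewrite gt_eqF.
  by rewrite sqrtrM ?sqr_ge0// sqrtr_sqr gtr0_norm.
have y1 : 0 < Num.sqrt (b^-1 ^+ 2 + 2) + 1 by rewrite ltr_wpDl ?sqrtr_ge0.
have y2 : 0 < Num.sqrt (2 * b^-1 ^+ 2 + 1) + b^-1.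
  by rewrite ltr_wpDl ?sqrtr_ge0// invr_gt0.
rewrite pE qE !lnM ?posrE//.
by ring.
Unshelve. all: end_near. Qed.

Lemma continuous_dir_marginal : continuous dir_marginal.
Proof.
move=> b; apply: cvgM.
  apply: cvgD.
    apply: cvgMr; apply: cvgV; first by rewrite gt_eqF// p_gt0.
    exact: cp.
  apply: cvgM; first exact: cvg_id.
  apply: cvgV; first by rewrite gt_eqF// q_gt0.
  exact: cq.
apply: cvgV; first by rewrite mulf_neq0 ?gt_eqF// ltr_pwDl// sqr_ge0.
apply: cvgMr; apply: cvgD; [exact: cvg_cst|exact: exprn_continuous].
Qed.

Lemma dir_marginal_ge0 b : 0 <= b -> 0 <= dir_marginal b.
Proof.
move=> b0; rewrite divr_ge0//.
  by rewrite addr_ge0// divr_ge0// sqrtr_ge0.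
by rewrite mulr_ge0// addr_ge0// sqr_ge0.
Qed.

Lemma integral_dir_marginal :
  (\int[mu]_(b in P) (dir_marginal b)%:E = (ln (1 + Num.sqrt 2))%:E)%E.
Proof.
rewrite (@ge0_integral_halfline_derive _ _ _ _ _ dPhi cPhi).
- congr EFin; rewrite /Phi /p /q expr0n mulr0 !addr0 sqrtr1 ln1 sub0r addrC.
  by rewrite (addrC (Num.sqrt 2)); field.
- exact: continuous_dir_marginal.
- exact: dir_marginal_ge0.
Qed.

End explicit_integrals.

(** * Slope and abscissa as coordinates on the quadrant *)

Section monotonicity.
Local Open Scope ereal_scope.

(** The integral of a nonnegative function is a supremum over the simple
    functions below it, hence monotone on arbitrary functions. *)
Lemma ge0_le_integral_any d (T : measurableType d) (R : realType)
    (mu : {measure set T -> \bar R}) (D : set T) (f g : T -> \bar R) :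
  (forall x, D x -> 0 <= f x) -> (forall x, D x -> f x <= g x) ->
  \int[mu]_(x in D) f x <= \int[mu]_(x in D) g x.
Proof.
move=> f0 fg; rewrite !ge0_integralE//; last first.
  by move=> x Dx; rewrite (le_trans (f0 _ Dx))// fg.
apply: le_ereal_sup => _ [h hf <-]; exists h => // x.
apply: (le_trans (hf x)); rewrite !patchE.
by case: ifPn => // /set_mem; exact: fg.
Qed.

End monotonicity.

Section measurability.
Context {R : realType} d (T : measurableType d).
Implicit Types f g : T -> R.

Lemma measurable_fun_sin f : measurable_fun setT f ->
  measurable_fun setT (fun x => sin (f x)).
Proof.
move=> mf; apply: (measurableT_comp _ mf).
by apply: continuous_measurable_fun; exact: continuous_sin.
Qed.

Lemma measurable_fun_gauss f g : measurable_fun setT f -> measurable_fun setT g ->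
  measurable_fun setT (fun x => gauss (f x) (g x)).
Proof.
move=> mf mg; apply: (measurableT_comp (f := expR)) => //.
apply: measurable_funN.
apply: measurable_funM => //; apply: measurable_funM => //.
exact: measurable_funX.
Qed.

End measurability.

Section polar.
Context {R : realType}.
Local Notation mu := (@lebesgue_measure R).
Local Notation P := (`]0%R, +oo[%classic : set R).
Local Open Scope ereal_scope.
Implicit Types F : R * R -> \bar R.

Let mP : measurable (P : set (measurableTypeR R)). Proof. exact: measurable_itv. Qed.

Definition cone_map (z : R * R) : R * R := (z.2, z.2 * z.1)%R.

Lemma measurable_cone_map : measurable_fun setT cone_map.
Proof.
by apply: measurable_fun_pair => //; exact: measurable_funM.
Qed.

Let mG F : measurable_fun setT F ->
  measurable_fun setT (fun z : R * R => (`|z.2|)%:E * F (cone_map z)).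
Proof.
move=> mF; apply: emeasurable_funM.
  by apply/measurable_EFinP; exact: measurableT_comp.
exact: (measurableT_comp mF measurable_cone_map).
Qed.

Let scale F u : measurable_fun setT F -> P u ->
  \int[mu]_(x in P) F (u, x) = \int[mu]_(a in P) ((`|u|)%:E * F (cone_map (a, u))).
Proof.
move=> mF; rewrite /= in_itv/= andbT => u0.
rewrite (integral_scale u0) ?ger0_norm ?ltW//.
exact: (measurableT_comp mF (measurable_pair1 u)).
Qed.

Let swap_measurable F : measurable_fun setT F ->
  measurable_fun setT (fun z : R * R => F (z.2, z.1)).
Proof.
move=> mF; apply: (measurableT_comp mF).
exact: (measurable_fun_pair measurable_snd measurable_fst).
Qed.

(** For fixed abscissa [u], the dilation by [u] turns ordinates into slopes. *)
Lemma ge0_integral_cone F : measurable_fun setT F -> (forall z, 0 <= F z) ->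
  \int[(mu \x mu)%E]_(z in P `*` P) F z =
  \int[mu]_(a in P) \int[mu]_(u in P) (u%:E * F (u, u * a)%R).
Proof.
move=> mF F0.
rewrite (@ge0_integral_setX _ _ (measurableTypeR R) (measurableTypeR R) R mu mu
  P P mP mP F)//; last exact: measurable_funTS.
under eq_integral => u uP do rewrite (scale mF (set_mem uP)).
pose G (z : R * R) := (`|z.1|)%:E * F (cone_map (z.2, z.1)).
have -> : \int[mu]_(u in P) \int[mu]_(a in P) ((`|u|)%:E * F (cone_map (a, u))) =
  \int[mu]_(a in P) \int[mu]_(u in P) G (u, a).
  apply: (@tonelli_setX _ _ (measurableTypeR R) (measurableTypeR R) R mu mu P P mP mP G).
    apply: measurable_funTS; exact: (swap_measurable (mG mF)).
  by move=> z; rewrite mule_ge0.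
apply: eq_integral => a _; apply: eq_integral => u /set_mem/=.
by rewrite in_itv/= andbT => u0; rewrite /G/= gtr0_norm.
Qed.

Lemma integral_cone F : measurable_fun setT F ->
  (mu \x mu)%E.-integrable (P `*` P) F ->
  \int[(mu \x mu)%E]_(z in P `*` P) F z =
  \int[mu]_(a in P) \int[mu]_(u in P) (u%:E * F (u, u * a)%R).
Proof.
move=> mF IF; rewrite (integral_setX mP mP)//.
under eq_integral => u uP do rewrite (scale mF (set_mem uP)).
pose G (z : R * R) := (`|z.1|)%:E * F (cone_map (z.2, z.1)).
have mGs : measurable_fun setT G by exact: (swap_measurable (mG mF)).
have IG : (mu \x mu)%E.-integrable (P `*` P) G.
  apply: (@integrable_setX _ _ (measurableTypeR R) (measurableTypeR R)) => //.
    exact: measurable_funTS.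
  have /integrableP[_] := IF.
  have mFa : measurable_fun setT (abse \o F) by exact: measurableT_comp.
  rewrite (@ge0_integral_setX _ _ (measurableTypeR R) (measurableTypeR R) R mu mu
    P P mP mP (abse \o F)); [|exact: measurable_funTS|by move=> z; exact: abse_ge0].
  apply: le_lt_trans; rewrite le_eqVlt; apply/orP; left; apply/eqP.
  apply: eq_integral => u uP; rewrite (scale mFa (set_mem uP)).
  by apply: eq_integral => a _; rewrite /G/= abseM/= normr_id.
have -> : \int[mu]_(u in P) \int[mu]_(a in P) ((`|u|)%:E * F (cone_map (a, u))) =
  \int[mu]_(a in P) \int[mu]_(u in P) G (u, a).
  exact: (@fubini_setX _ _ (measurableTypeR R) (measurableTypeR R) R mu mu P P mP mP G).
apply: eq_integral => a _; apply: eq_integral => u /set_mem/=.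
by rewrite in_itv/= andbT => u0; rewrite /G/= gtr0_norm.
Qed.

End polar.

(** * The bound for Borel inputs *)

Section quadrant_rays.
Context {R : realType}.
Local Notation mu := (@lebesgue_measure R).
Local Notation P := (`]0%R, +oo[%classic : set R).
Implicit Types (H : R * R -> R) (a b u v : R).

Let mP : measurable (P : set (measurableTypeR R)). Proof. exact: measurable_itv. Qed.

Definition plane_gauss (x : R * R) : R := expR (- (norm2 x ^+ 2 / 2)).

Lemma sqr_norm2 (x : R * R) : norm2 x ^+ 2 = x.1 ^+ 2 + x.2 ^+ 2.
Proof. by rewrite /norm2 /dot2 -!expr2 sqr_sqrtr// addr_ge0// sqr_ge0. Qed.

Lemma plane_gaussE x : plane_gauss x = gauss 1 x.1 * gauss 1 x.2.
Proof.
by rewrite /plane_gauss sqr_norm2 /gauss -expRD; congr expR; ring.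
Qed.

Lemma plane_gauss_ge0 x : 0 <= plane_gauss x.
Proof. exact: expR_ge0. Qed.

Lemma plane_gauss_ray a u : plane_gauss (u, u * a) = gauss (1 + a ^+ 2) u.
Proof. by rewrite /plane_gauss sqr_norm2 /gauss/=; congr expR; ring. Qed.

Lemma dot2_ray a b u v : dot2 (u, u * a) (v, v * b) = (1 + a * b) * v * u.
Proof. by rewrite /dot2/=; ring. Qed.

Lemma measurable_plane_gauss : measurable_fun setT plane_gauss.
Proof.
rewrite (_ : plane_gauss = fun z => gauss 1 z.1 * gauss 1 z.2); last first.
  by apply/funext => z; rewrite plane_gaussE.
by apply: measurable_funM; apply: measurable_fun_gauss.
Qed.

Lemma integrable_plane_gauss :
  (mu \x mu)%E.-integrable (P `*` P) (EFin \o plane_gauss).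
Proof.
have mE : measurable_fun setT (EFin \o plane_gauss).
  by apply/measurable_EFinP; exact: measurable_plane_gauss.
apply: (@integrable_setX _ _ (measurableTypeR R) (measurableTypeR R)) => //.
  exact: measurable_funTS.
have g1 : (0 : R) < 1 by [].
have inner x : (\int[mu]_(y in P) `|(EFin \o plane_gauss) (x, y)| =
    (Num.sqrt (pi / (2 * 1)))%:E * (gauss 1 x)%:E)%E.
  rewrite -(integral_gauss g1) muleC -ge0_integralZl//; last 3 first.
  - by apply/measurable_EFinP/measurable_funTS; exact: measurable_gauss.
  - by move=> y _; rewrite lee_fin gauss_ge0.
  - by rewrite lee_fin gauss_ge0.
  apply: eq_integral => y _ /=.
  by rewrite ger0_norm ?plane_gauss_ge0// plane_gaussE.
under eq_integral do rewrite inner.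
rewrite ge0_integralZl//; last 2 first.
- by apply/measurable_EFinP/measurable_funTS; exact: measurable_gauss.
- by move=> x _; rewrite lee_fin gauss_ge0.
by rewrite (integral_gauss g1) -EFinM ltry.
Qed.

Definition ray_fun H a u := H (u, u * a) * (u * gauss (1 + a ^+ 2) u).

(** The contribution of the ray of slope [z.1] to the value of [borel_sine H] at
    the point of abscissa [z.2] on the ray of slope [b]. *)
Definition ray_transform H b (z : R * R) :=
  sine_transform (1 + z.1 * b) (ray_fun H z.1) z.2.

Section bounded_input.
Variable H : R * R -> R.
Hypotheses (mH : measurable_fun setT H) (H1 : forall x, `|H x| <= 1).

Definition borel_sine (y : R * R) : R :=
  \int[(mu \x mu)%E]_(x in P `*` P) (H x * plane_gauss x * sin (dot2 x y)).

Let integrand y (x : R * R) := H x * plane_gauss x * sin (dot2 x y).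

Let measurable_integrand2 :
  measurable_fun setT (fun z : (R * R) * (R * R) => integrand z.1 z.2).
Proof.
apply: measurable_funM.
  apply: measurable_funM; first exact: (measurableT_comp mH measurable_snd).
  exact: (measurableT_comp measurable_plane_gauss measurable_snd).
apply: measurable_fun_sin; apply: measurable_funD; apply: measurable_funM.
- exact: (measurableT_comp measurable_fst measurable_snd).
- exact: (measurableT_comp measurable_fst measurable_fst).
- exact: (measurableT_comp measurable_snd measurable_snd).
- exact: (measurableT_comp measurable_snd measurable_fst).
Qed.

Lemma measurable_borel_integrand y : measurable_fun setT (integrand y).
Proof. exact: (measurableT_comp measurable_integrand2 (measurable_pair1 y)). Qed.

Lemma integrable_borel_integrand y :
  (mu \x mu)%E.-integrable (P `*` P) (EFin \o integrand y).
Proof.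
apply: (@le_integrable _ _ _ (mu \x mu)%E (P `*` P) _ _ (EFin \o plane_gauss)).
- exact: (measurableX mP mP).
- by apply/measurable_EFinP; apply: measurable_funTS; exact: measurable_borel_integrand.
- move=> x _; rewrite /= lee_fin /integrand mulrAC normrM.
  by rewrite ler_piMl// normrM mulr_ile1// sin_max.
- exact: integrable_plane_gauss.
Qed.

(** Through the iterated integral, so that [measurable_Rintegral_parameter]
    applies to each variable in turn. *)
Lemma measurable_borel_sine : measurable_fun setT borel_sine.
Proof.
have -> : borel_sine = fun y => \int[mu]_(x1 in P) \int[mu]_(x2 in P)
    integrand y (x1, x2).
  apply/funext => y; rewrite /borel_sine /Rintegral; congr fine.
  rewrite (integral_setX mP mP (integrable_borel_integrand y)).
  apply: eq_integral => x1 _; rewrite fineK//; apply: integrable_fin_num => //.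
  apply: (@integrable_gauss_bound _ (fun x2 => integrand y (x1, x2)) (gauss 1 x1) 1) => //.
    exact: (measurableT_comp (measurable_borel_integrand y) (measurable_pair1 x1)).
  move=> x2 _; rewrite -(plane_gaussE (x1, x2)) /integrand mulrAC normrM.
  rewrite (ger0_norm (plane_gauss_ge0 _)) ler_piMl ?plane_gauss_ge0//.
  by rewrite normrM mulr_ile1// sin_max.
pose f (z : ((R * R) * R) * R) := integrand z.1.1 (z.1.2, z.2).
have mf : measurable_fun setT f.
  pose r (z : ((R * R) * R) * R) := (z.1.1, (z.1.2, z.2)).
  apply: (measurableT_comp measurable_integrand2 (g := r)).
  apply: measurable_fun_pair; first exact: (measurableT_comp measurable_fst measurable_fst).
  apply: measurable_fun_pair => //.
  exact: (measurableT_comp measurable_snd measurable_fst).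
have mf1 : measurable_fun setT (fun z : (R * R) * R => \int[mu]_(x2 in P) f (z, x2)).
  exact: (@measurable_Rintegral_parameter _ _
    ((measurableTypeR R * measurableTypeR R) * measurableTypeR R)%type
    (measurableTypeR R) R mu P mP f mf).
exact: (@measurable_Rintegral_parameter _ _ (measurableTypeR R * measurableTypeR R)%type
  (measurableTypeR R) R mu P mP (fun z => \int[mu]_(x2 in P) f (z, x2)) mf1).
Qed.

Lemma measurable_ray_fun a : measurable_fun setT (ray_fun H a).
Proof.
apply: measurable_funM.
  apply: (measurableT_comp mH); apply: measurable_fun_pair => //.
  exact: measurable_funM.
by apply: measurable_funM => //; exact: measurable_gauss.
Qed.

Lemma ray_fun_bound a u : 0 < u -> `|ray_fun H a u| <= u * gauss (1 + a ^+ 2) u.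
Proof.
move=> u0; rewrite normrM (ger0_norm (x := u * _)).
  by rewrite ler_piMl// mulr_ge0 ?gauss_ge0// ltW.
by rewrite mulr_ge0 ?gauss_ge0// ltW.
Qed.

Lemma ray_transformE a b v :
  (\int[mu]_(u in P) (u%:E * (integrand (v, v * b) (u, u * a))%:E) =
   (ray_transform H b (a, v))%:E)%E.
Proof.
have a1 : 0 < 1 + a ^+ 2 by rewrite ltr_pwDl// sqr_ge0.
have E u : (u%:E * (integrand (v, v * b) (u, u * a))%:E)%E =
    (ray_fun H a u * sin ((1 + a * b) * v * u))%:E.
  rewrite -EFinM /integrand dot2_ray plane_gauss_ray /ray_fun.
  by congr EFin; ring.
under eq_integral do rewrite E.
rewrite /ray_transform /sine_transform /Rintegral fineK//.
apply: integrable_fin_num => //.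
apply: (@integrable_gauss_bound _ _ (1 + 4 / (1 + a ^+ 2)) ((1 + a ^+ 2) / 2)).
- by rewrite divr_gt0.
- apply: measurable_funM; first exact: measurable_ray_fun.
  by apply: measurable_fun_sin; exact: measurable_funM.
- move=> u u0; rewrite normrM (le_trans (ler_piMr _ (sin_max _)))//.
  by rewrite (le_trans (ray_fun_bound _ u0))// mul_gauss_le.
Qed.

Lemma borel_sine_ray v b :
  ((borel_sine (v, v * b))%:E = \int[mu]_(a in P) (ray_transform H b (a, v))%:E)%E.
Proof.
rewrite /borel_sine /Rintegral fineK; last first.
  apply: integrable_fin_num; first exact: (measurableX mP mP).
  exact: integrable_borel_integrand.
rewrite (@integral_cone _ (EFin \o integrand (v, v * b))).
- by apply: eq_integral => a _; rewrite -ray_transformE.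
- by apply/measurable_EFinP; exact: measurable_borel_integrand.
- exact: integrable_borel_integrand.
Qed.

Lemma measurable_ray_transform b : measurable_fun setT (ray_transform H b).
Proof.
pose f (z : (R * R) * R) := ray_fun H z.1.1 z.2 * sin ((1 + z.1.1 * b) * z.1.2 * z.2).
have m11 : measurable_fun setT (fun z : (R * R) * R => z.1.1).
  exact: (measurableT_comp measurable_fst measurable_fst).
have m12 : measurable_fun setT (fun z : (R * R) * R => z.1.2).
  exact: (measurableT_comp measurable_snd measurable_fst).
apply: (@measurable_Rintegral_parameter _ _ (measurableTypeR R * measurableTypeR R)%type
  (measurableTypeR R) R mu P mP f).
apply: measurable_funM.
  apply: measurable_funM.
    apply: (measurableT_comp mH); apply: measurable_fun_pair => //.
    exact: measurable_funM.
  apply: measurable_funM => //; apply: measurable_fun_gauss => //.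
  by apply: measurable_funD => //; exact: measurable_funX.
apply: measurable_fun_sin; apply: measurable_funM => //; apply: measurable_funM => //.
by apply: measurable_funD => //; exact: measurable_funM.
Qed.

Definition borel_sine_norm : \bar R :=
  (\int[(mu \x mu)%E]_(y in P `*` P) (plane_gauss y * `|borel_sine y|)%:E)%E.

Lemma borel_sine_norm_rays : borel_sine_norm =
  (\int[mu]_(b in P) \int[mu]_(v in P)
     ((v * gauss (1 + b ^+ 2) v)%:E * `|\int[mu]_(a in P) (ray_transform H b (a, v))%:E|))%E.
Proof.
pose F y : \bar R := (plane_gauss y * `|borel_sine y|)%:E.
have mF : measurable_fun setT F.
  apply/measurable_EFinP; apply: measurable_funM; first exact: measurable_plane_gauss.
  by apply: measurableT_comp => //; exact: measurable_borel_sine.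
have F0 y : (0 <= F y)%E by rewrite lee_fin mulr_ge0 ?plane_gauss_ge0.
rewrite /borel_sine_norm (ge0_integral_cone mF F0).
apply: eq_integral => b _; apply: eq_integral => v _.
by rewrite /F -borel_sine_ray plane_gauss_ray abse_EFin -!EFinM mulrA.
Qed.

Lemma ray_tonelli b :
  (\int[mu]_(v in P) ((v * gauss (1 + b ^+ 2) v)%:E *
     \int[mu]_(a in P) (`|ray_transform H b (a, v)|)%:E) =
   \int[mu]_(a in P) \int[mu]_(v in P)
     (v * gauss (1 + b ^+ 2) v * `|ray_transform H b (a, v)|)%:E)%E.
Proof.
pose G (z : R * R) := (`|z.2| * gauss (1 + b ^+ 2) z.2 * `|ray_transform H b z|)%:E.
have mr := measurable_ray_transform b.
have mG : measurable_fun setT G.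
  apply/measurable_EFinP; apply: measurable_funM; last exact: measurableT_comp.
  apply: measurable_funM; first exact: measurableT_comp.
  exact: measurable_fun_gauss.
have G0 z : (0 <= G z)%E by rewrite lee_fin !mulr_ge0 ?gauss_ge0.
transitivity (\int[mu]_(v in P) \int[mu]_(a in P) G (a, v))%E.
  apply: eq_integral => v /set_mem/=; rewrite in_itv/= andbT => v0.
  rewrite -ge0_integralZl//; last 2 first.
  - apply: measurable_funTS; apply/measurable_EFinP; apply: measurableT_comp => //.
    exact: (measurableT_comp mr (measurable_pair2 v)).
  - by rewrite lee_fin mulr_ge0 ?gauss_ge0 ?ltW.
  by apply: eq_integral => a _; rewrite /G/= (gtr0_norm v0).
have mGP : @measurable_fun _ _ (measurableTypeR R * measurableTypeR R)%type _ (P `*` P) G.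
  exact: measurable_funTS.
rewrite -(@tonelli_setX _ _ (measurableTypeR R) (measurableTypeR R) R mu mu P P mP mP G mGP G0).
apply: eq_integral => a _; apply: eq_integral => v /set_mem/=.
by rewrite in_itv/= andbT => v0; rewrite /G/= (gtr0_norm v0).
Qed.

Lemma measurable_ray_norm b : measurable_fun setT (fun a => \int[mu]_(v in P)
     (v * gauss (1 + b ^+ 2) v * `|ray_transform H b (a, v)|)%:E)%E.
Proof.
pose G (z : R * R) := (`|z.2| * gauss (1 + b ^+ 2) z.2 * `|ray_transform H b z|)%:E.
have mr := measurable_ray_transform b.
rewrite (_ : (fun a => _) = fun a => \int[mu]_(v in P) G (a, v))%E; last first.
  apply/funext => a; apply: eq_integral => v /set_mem/=.
  by rewrite in_itv/= andbT => v0; rewrite /G/= (gtr0_norm v0).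
apply: (@measurable_ge0_integral_parameter _ _ (measurableTypeR R)
  (measurableTypeR R) R mu P mP G).
  apply/measurable_EFinP; apply: measurable_funM; last exact: measurableT_comp.
  apply: measurable_funM; first exact: measurableT_comp.
  exact: measurable_fun_gauss.
by move=> z; rewrite lee_fin !mulr_ge0 ?gauss_ge0.
Qed.

Lemma ray_norm_le a b : 0 < a -> 0 < b -> a != b ->
  (\int[mu]_(v in P) (v * gauss (1 + b ^+ 2) v * `|ray_transform H b (a, v)|)%:E <=
   (pi / 2 * dir_weight a b)%:E)%E.
Proof.
move=> a0 b0 ab.
have a1 : 0 < 1 + a ^+ 2 by rewrite ltr_pwDl// sqr_ge0.
have b1 : 0 < 1 + b ^+ 2 by rewrite ltr_pwDl// sqr_ge0.
have g1 : 0 < 1 + a * b by rewrite addr_gt0// mulr_gt0.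
have d : (1 + a * b) ^+ 2 < (1 + a ^+ 2) * (1 + b ^+ 2).
  rewrite -subr_gt0 (_ : _ - _ = (a - b) ^+ 2); last by ring.
  by rewrite exprn_even_gt0//= subr_eq0.
rewrite /dir_weight mulrA -integral_gauss_sin_ray//.
have := ray_bound a1 g1 d (measurable_ray_fun a) (ray_fun_bound a).
exact.
Qed.

End bounded_input.

Lemma integral_pi_dir_weight :
  (\int[mu]_(b in P) \int[mu]_(a in P) (pi / 2 * dir_weight a b)%:E =
   (pi / 2 * ln (1 + Num.sqrt 2))%:E)%E.
Proof.
have p2 : (0 : R) <= pi / 2 by rewrite divr_ge0 ?pi_ge0.
transitivity (\int[mu]_(b in P) ((pi / 2)%:E * (dir_marginal b)%:E))%E.
  apply: eq_integral => b /set_mem/=; rewrite in_itv/= andbT => b0.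
  have mw : measurable_fun setT (dir_weight ^~ b).
    exact: (continuous_measurable_fun (@continuous_dir_weight _ b)).
  rewrite -integral_dir_weight ?ltW// -ge0_integralZl//.
    by apply/measurable_EFinP; exact: measurable_funTS.
  move=> a; rewrite /= in_itv/= andbT => a0.
  by rewrite lee_fin dir_weight_ge0// ltW.
have mm : measurable_fun setT (@dir_marginal R).
  exact: (continuous_measurable_fun (@continuous_dir_marginal _)).
rewrite ge0_integralZl ?integral_dir_marginal//.
  by apply/measurable_EFinP; exact: measurable_funTS.
move=> b; rewrite /= in_itv/= andbT => b0.
by rewrite lee_fin dir_marginal_ge0// ltW.
Qed.

(** Triangle inequality over the slopes [a], Tonelli, and [ray_norm_le]. *)
Theorem borel_sine_norm_le H : measurable_fun setT H -> (forall x, `|H x| <= 1) ->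
  (borel_sine_norm H <= (pi / 2 * ln (1 + Num.sqrt 2))%:E)%E.
Proof.
move=> mH H1; rewrite borel_sine_norm_rays// -integral_pi_dir_weight.
apply: ge0_le_integral_any => b.
  move=> _; apply: integral_ge0 => v; rewrite /= in_itv/= andbT => v0.
  by rewrite mule_ge0// lee_fin mulr_ge0 ?gauss_ge0// ltW.
rewrite /= in_itv/= andbT => b0.
apply: (@le_trans _ _ (\int[mu]_(v in P) ((v * gauss (1 + b ^+ 2) v)%:E *
     \int[mu]_(a in P) (`|ray_transform H b (a, v)|)%:E))%E).
  apply: ge0_le_integral_any => v; rewrite /= in_itv/= andbT => v0.
    by rewrite mule_ge0// lee_fin mulr_ge0 ?gauss_ge0// ltW.
  apply: lee_wpmul2l; first by rewrite lee_fin mulr_ge0 ?gauss_ge0// ltW.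
  have mr : measurable_fun setT (fun a => ray_transform H b (a, v)).
    exact: (measurableT_comp (measurable_ray_transform mH b) (measurable_pair2 v)).
  have := @le_abse_integral _ (measurableTypeR R) R mu P
    (fun a => (ray_transform H b (a, v))%:E) mP.
  by apply; apply/measurable_EFinP; exact: measurable_funTS.
rewrite ray_tonelli//.
(* [ray_norm_le] needs distinct slopes; a single slope is a null set. *)
have mPb : measurable ((P `\ b) : set (measurableTypeR R)).
  by apply: measurableD => //; exact: measurable_set1.
have mn := measurable_ray_norm mH b.
have mw : measurable_fun setT (fun a => (pi / 2 * dir_weight a b)%:E).
  apply/measurable_EFinP; apply: measurable_funM => //.
  by apply: continuous_measurable_fun; exact: continuous_dir_weight.
rewrite -(@integral_setD1 _ _ b P mPb (measurable_funTS mn)).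
rewrite -(@integral_setD1 _ _ b P mPb (measurable_funTS mw)).
apply: ge0_le_integral_any => a [].
  move=> _ _; apply: integral_ge0 => v; rewrite /= in_itv/= andbT => v0.
  by rewrite lee_fin !mulr_ge0 ?gauss_ge0// ltW.
rewrite /= in_itv/= andbT => a0 /eqP ab.
exact: ray_norm_le.
Qed.

(** The transforms [gauss_sin] are nonnegative, so the triangle inequality is an
    equality, and [integral_gauss_sin_ray] replaces [ray_bound]. *)
Theorem borel_sine_norm1 :
  borel_sine_norm (fun=> 1) = (pi / 2 * ln (1 + Num.sqrt 2))%:E.
Proof.
have m1 : measurable_fun setT (fun _ : R * R => 1 : R) by exact: measurable_cst.
have n1 (x : R * R) : `|(1 : R)| <= 1 by rewrite normr1.
rewrite borel_sine_norm_rays// -integral_pi_dir_weight.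
have rE a b v : ray_transform (fun=> 1) b (a, v) =
    gauss_sin (1 + a ^+ 2) ((1 + a * b) * v).
  rewrite /ray_transform/= /sine_transform /gauss_sin.
  by apply: eq_Rintegral => u _; rewrite /ray_fun mul1r.
have r0 a b v : 0 < a -> 0 < b -> 0 < v -> 0 <= ray_transform (fun=> 1) b (a, v).
  move=> a0 b0 v0; rewrite rE gauss_sin_ray_ge0// ?ltr_pwDl ?sqr_ge0//.
  by rewrite mulr_ge0// ltW.
apply: eq_integral => b /set_mem/=; rewrite in_itv/= andbT => b0.
transitivity (\int[mu]_(v in P) ((v * gauss (1 + b ^+ 2) v)%:E *
     \int[mu]_(a in P) (`|ray_transform (fun=> 1) b (a, v)|)%:E))%E.
  apply: eq_integral => v /set_mem/=; rewrite in_itv/= andbT => v0.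
  congr (_ * _)%E; rewrite gee0_abs.
    apply: eq_integral => a /set_mem/=; rewrite in_itv/= andbT => a0.
    by rewrite ger0_norm// r0.
  apply: integral_ge0 => a; rewrite /= in_itv/= andbT => a0.
  by rewrite lee_fin r0.
rewrite ray_tonelli//.
apply: eq_integral => a /set_mem/=; rewrite in_itv/= andbT => a0.
have a1 : 0 < 1 + a ^+ 2 by rewrite ltr_pwDl// sqr_ge0.
have b1 : 0 < 1 + b ^+ 2 by rewrite ltr_pwDl// sqr_ge0.
have g1 : 0 < 1 + a * b by rewrite addr_gt0// mulr_gt0.
rewrite /dir_weight mulrA -integral_gauss_sin_ray//.
apply: eq_integral => v /set_mem/=; rewrite in_itv/= andbT => v0.
by rewrite ger0_norm ?r0// rE.
Qed.

End quadrant_rays.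

(** * Borel modifications of functions measurable for the completion *)

Section borel_modification.
Context d (T : measurableType d) (R : realType).
Variable mu : {measure set T -> \bar R}.
Local Notation mu' := (mu_ext mu).
Local Notation U := (caratheodory_type mu').

(** Intersect countable covers of measure at most [mu' X + n.+1%:R^-1]. *)
Lemma mu_ext_cover (X : set T) :
  exists B, [/\ measurable B, X `<=` B & mu B = mu' X].
Proof.
have [Xoo|Xfin] := eqVneq (mu' X) +oo%E.
  exists setT; split => //; apply/eqP; rewrite Xoo eq_le leey/= -Xoo.
  by rewrite -(@measurable_mu_extE _ _ _ mu)//; exact: le_mu_ext.
have Xnum : mu' X \is a fin_num.
  by rewrite ge0_fin_numE ?ltey//; exact: mu_ext_ge0.
have cover n : exists F, measurable_cover X F /\
    (\sum_(k <oo) mu (F k) < mu' X + (n.+1%:R^-1)%:E)%E.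
  have n0 : 0 < n.+1%:R^-1 :> R by rewrite invr_gt0.
  by have [_ [F XF <-] ?] := lb_ereal_inf_adherent n0 Xnum; exists F.
have [F FP] := choice cover.
pose B := \bigcap_n \bigcup_k F n k.
have mF n : measurable (\bigcup_k F n k).
  by apply: bigcupT_measurable => k; have [[+ _] _] := FP n.
have mB : measurable B by exact: bigcapT_measurable.
have XB : X `<=` B.
  by move=> x Xx n _; have [[_ +] _] := FP n; exact.
exists B; split => //; apply/eqP; rewrite eq_le; apply/andP; split; last first.
  by rewrite -(@measurable_mu_extE _ _ _ mu)//; exact: le_mu_ext.
apply/lee_addgt0Pr => e e0.
pose n := Num.truncn (e^-1).
have ne : n.+1%:R^-1 < e.
  by rewrite invf_plt ?posrE// truncnS_gt.
apply: (@le_trans _ _ (mu (\bigcup_k F n k))).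
  by apply: le_measure; rewrite ?inE//; exact: bigcap_inf.
apply: (@le_trans _ _ (\sum_(k <oo) mu (F n k))%E).
  apply: measure_sigma_subadditive => //.
  by move=> k; have [[+ _] _] := FP n.
have [_ /ltW/le_trans] := FP n; apply.
by rewrite leeD2l// lee_fin ltW.
Qed.

Hypothesis sf : sigma_finite setT mu.

Lemma measure0_bigcup (F : nat -> set T) : (forall k, measurable (F k)) ->
  (forall k, mu (F k) = 0%E) -> mu (\bigcup_k F k) = 0%E.
Proof.
move=> mF F0; apply/eqP; rewrite eq_le measure_ge0 andbT.
apply: (le_trans (measure_sigma_subadditive mu mF _ _)) => //.
  exact: bigcupT_measurable.
by rewrite eseries0// => k _ _; exact: F0.
Qed.

Lemma measure0_bigcup_countable (I : countType) (F : I -> set T) :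
  (forall i, measurable (F i)) -> (forall i, mu (F i) = 0%E) ->
  mu (\bigcup_i F i) = 0%E.
Proof.
move=> mF F0; pose G k := if unpickle k is Some i then F i else set0.
have -> : \bigcup_i F i = \bigcup_k G k.
  apply/seteqP; split => x.
    by move=> [i _ Fix]; exists (pickle i) => //; rewrite /G pickleK.
  by move=> [k _]; rewrite /G; case: unpickle => // i Fix; exists i.
by apply: measure0_bigcup => k; rewrite /G; case: unpickle.
Qed.

(** On a piece of finite measure, the Caratheodory criterion applied to a
    measurable cover shows that the cover exceeds the set by a null set, which in
    turn has a measurable null cover. *)
Lemma caratheodory_borel (A : set U) : measurable A ->
  exists B N : set T, [/\ measurable B, measurable N, mu N = 0%E &
    forall x, ~ N x -> (A x <-> B x)].
Proof.
move=> mA.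
have [S TS Soo] := sf.
pose A_ k : set U := A `&` S k.
have mA_ k : measurable (A_ k).
  apply: measurableI => //.
  by apply: caratheodory_measurable_mu_ext; have [] := Soo k.
have [B BP] := choice (fun k => mu_ext_cover (A_ k)).
have A_fin k : mu' (A_ k) \is a fin_num.
  rewrite ge0_fin_numE; last exact: mu_ext_ge0.
  have [mS Sk] := Soo k; apply: le_lt_trans Sk.
  by rewrite -(@measurable_mu_extE _ _ _ mu)//; apply: le_mu_ext; exact: subIsetr.
have C0 k : mu' (B k `&` ~` A_ k) = 0%E.
  have [mB AB muB] := BP k.
  have E : (mu' (A_ k) = mu' (B k `&` ~` A_ k) + mu' (A_ k))%E.
    have := mA_ k (B k); rewrite (setIidr AB) addeC.
    by rewrite [X in X = _](@measurable_mu_extE _ _ _ mu)// muB.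
  by rewrite -[LHS](addeK _ (A_fin k)) -E subee.
have [N NP] := choice (fun k => mu_ext_cover (B k `&` ~` A_ k)).
exists (\bigcup_k B k), (\bigcup_k N k); split.
- by apply: bigcupT_measurable => k; have [] := BP k.
- by apply: bigcupT_measurable => k; have [] := NP k.
- apply: measure0_bigcup => k; first by have [] := NP k.
  by have [_ _ ->] := NP k; exact: C0.
- move=> x Nx; split => [Ax|[k _ Bkx]].
    have : [set: T] x by [].
    rewrite TS => -[k _ Skx]; exists k => //.
    by have [_ AB _] := BP k; apply: AB; split.
  have [//|Ax] := pselect (A x).
  exfalso; apply: Nx; exists k => //.
  have [_ CN _] := NP k; apply: CN; split => //.
  by move=> [].
Qed.

(** Off one null set [N], every superlevel set of [h] at a rational level is
    measurable; these countably many sets determine [h], so [h] is measurable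
    off [N]. *)
Lemma borel_modification (D : set T) (h : U -> R) : measurable D ->
  measurable_fun (D : set U) h -> (forall x, D x -> `|h x| <= 1) ->
  exists (H : T -> R) (N : set T), [/\ measurable_fun setT H,
    forall x, `|H x| <= 1, measurable N, mu N = 0%E &
    forall x, D x -> ~ N x -> h x = H x].
Proof.
move=> mD mh h1.
have mDU : measurable (D : set U) by exact: caratheodory_measurable_mu_ext.
pose g : U -> R := h \_ D.
have mg : measurable_fun setT g by apply/(measurable_restrictT _ mDU).
have gle1 x : `|g x| <= 1.
  by rewrite /g patchE; case: ifPn => [/set_mem/h1//|_]; rewrite normr0.
pose A (q : rat) : set U := g @^-1` `]ratr q, +oo[%classic.
have mA q : measurable (A q).
  by rewrite -[A q]setTI; apply: mg => //; exact: measurable_itv.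
have [B BP] := choice (fun q => caratheodory_borel (mA q)).
have [N NP] := choice BP.
pose N0 := \bigcup_q N q.
have mN0 : measurable N0.
  by apply: bigcupT_measurable_rat => q; have [] := NP q.
have N00 : mu N0 = 0%E.
  by apply: measure0_bigcup_countable => q; have [] := NP q.
pose H x : R := if x \in N0 then 0 else g x.
exists H, N0; split => //.
- apply: (measurability _ (RGenOInfty.measurableE R)) => _ [_ [r ->] <-].
  rewrite setTI.
  have -> : H @^-1` `]r, +oo[%classic =
      \bigcup_(q in [set q : rat | r < ratr q]) (B q `\` N0) `|`
      (if r < 0 then N0 else set0).
    apply/seteqP; split => x /=; rewrite in_itv/= andbT /H.
      case: ifPn => [/set_mem xN r0|xN rg]; first by right; rewrite r0.
      left; have [q] := rat_in_itvoo rg; rewrite in_itv/= => /andP[rq qg].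
      have Nx : ~ N0 x by move/negP: xN; apply: contra_not => ?; exact: mem_set.
      exists q => //; split => //.
      have [_ _ _ AB] := NP q; apply/AB; last by rewrite /A/= in_itv/= qg.
      by move=> Nqx; apply: Nx; exists q.
    case=> [[q /= rq [Bqx Nx]]|].
      rewrite memNset//; apply: (lt_trans rq).
      have [_ _ _ AB] := NP q.
      have : A q x by apply/AB => // Nqx; apply: Nx; exists q.
      by rewrite /A/= in_itv/= andbT.
    by case: ifPn => // r0 N0x; rewrite mem_set.
  apply: measurableU; last by case: ifP.
  rewrite bigcup_mkcond; apply: bigcupT_measurable_rat => q.
  by case: ifPn => // _; apply: measurableD => //; have [] := NP q.
- by move=> x; rewrite /H; case: ifPn => // _; rewrite normr0.
- by move=> x Dx Nx; rewrite /H memNset// /g patchE mem_set.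
Qed.

End borel_modification.

(** * From the Lebesgue plane to the Borel plane *)

Section completion.
Local Open Scope ereal_scope.
Context d (T : measurableType d) (R : realType).
Variable mu : {measure set T -> \bar R}.
Local Notation U := (caratheodory_type (mu_ext mu)).
Local Notation nu := (@completed_measure_extension d T R mu).

Lemma measurable_fun_completion d' (V : measurableType d') (D : set T) (f : T -> V) :
  measurable D -> measurable_fun D f -> measurable_fun (D : set U) (f : U -> V).
Proof.
move=> mD mf _ Y mY; apply: caratheodory_measurable_mu_ext.
exact: mf.
Qed.

(** The measure is the image of its completion under the identity map. *)
Lemma ge0_integral_completion (D : set T) (f : T -> \bar R) : measurable D ->
  measurable_fun D f -> (forall x, 0 <= f x) ->
  \int[nu]_(x in D) f x = \int[mu]_(x in D) f x.
Proof.
move=> mD mf f0; pose phi : U -> T := id.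
have mphi : measurable_fun setT phi.
  by apply: measurable_fun_completion => //; exact: measurable_id.
pose pnu : {measure set T -> \bar R} := pushforward nu phi.
transitivity (\int[pnu mphi]_(x in D) f x).
  by rewrite ge0_integral_pushforward.
apply: eq_measure_integral => A mA _.
exact: measurable_mu_extE.
Qed.

Lemma integral_completion (D : set T) (f : T -> \bar R) : measurable D ->
  measurable_fun D f ->
  \int[nu]_(x in D) f x = \int[mu]_(x in D) f x.
Proof.
move=> mD mf; rewrite [LHS]integralE [RHS]integralE.
by rewrite !ge0_integral_completion//;
  [exact: measurable_funeneg|exact: measurable_funepos].
Qed.

Lemma integral_negligible_setD (D N : set T) (f : T -> \bar R) :
  measurable N -> measurable D -> measurable_fun D f -> mu N = 0 ->
  \int[mu]_(x in D) f x = \int[mu]_(x in D `\` N) f x.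
Proof.
move=> mN mD mf N0; rewrite [LHS]integralE [RHS]integralE.
rewrite (ge0_negligible_integral mN mD (measurable_funepos mf))//.
by rewrite (ge0_negligible_integral mN mD (measurable_funeneg mf)).
Qed.

End completion.

Section plane.
Context {R : realType}.
Local Notation mu := (@lebesgue_measure R).
Local Notation bpm := (@borel_plane_measure R).
Local Notation P := (`]0%R, +oo[%classic : set R).
Local Notation Q := (@quadrant R).

Let mP : measurable (P : set (measurableTypeR R)). Proof. exact: measurable_itv. Qed.

Lemma borel_plane_measure_setX (A B : set (measurableTypeR R)) :
  measurable A -> measurable B -> bpm (A `*` B) = (mu A * mu B)%E.
Proof. exact: product_measure1E. Qed.

Lemma sigma_finite_borel_plane : sigma_finite setT bpm.
Proof.
have /sigma_finiteP[F [TF ndF Foo]] := sigma_finiteT mu.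
exists (fun n => F n `*` F n).
  rewrite -setXTT TF predeqE => -[x y]; split.
    move=> [/= [n _ Fnx] [k _ Fky]]; exists (maxn n k) => //; split.
    - by move: x Fnx; exact/subsetPset/ndF/leq_maxl.
    - by move: y Fky; exact/subsetPset/ndF/leq_maxr.
  by move=> [n _ []/= ? ?]; split; exists n.
move=> k; have [mF Fk] := Foo k; split; first exact: measurableX.
rewrite borel_plane_measure_setX//.
by rewrite lte_mul_pinfty// ge0_fin_numE.
Qed.

Let C : set R := `[0%R, +oo[%classic.

Let mC : measurable (C : set (measurableTypeR R)). Proof. exact: measurable_itv. Qed.

Lemma quadrant_setX : Q = C `*` C.
Proof. by apply/seteqP; split => x; rewrite /quadrant /C/= !in_itv/= !andbT. Qed.

Lemma measurable_quadrant :
  measurable (Q : set (measurableTypeR R * measurableTypeR R)).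
Proof. by rewrite quadrant_setX; exact: measurableX. Qed.

Let axes : set (R * R) := ([set 0] `*` setT) `|` (setT `*` [set 0]).

Let m0 : measurable ([set 0] : set (measurableTypeR R)).
Proof. exact: measurable_set1. Qed.

Lemma measurable_axes : measurable (axes : set (measurableTypeR R * measurableTypeR R)).
Proof. by apply: measurableU; exact: measurableX. Qed.

Lemma axes_null : bpm axes = 0%E.
Proof.
apply/eqP; rewrite eq_le measure_ge0 andbT.
apply: (le_trans (measureU2 _ _ _)); [exact: measurableX|exact: measurableX|].
change (bpm ([set 0%R] `*` setT) + bpm (setT `*` [set 0%R]) <= 0)%E.
rewrite !borel_plane_measure_setX//.
by rewrite lebesgue_measure_set1 mul0e mule0 adde0.
Qed.

Lemma quadrant_setD_axes : Q `\` axes = P `*` P.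
Proof.
apply/seteqP; split => -[x y]; rewrite /quadrant /axes/= !in_itv/= !andbT.
  move=> [[x0 y0] /not_orP[Nx Ny]]; rewrite !lt_neqAle x0 y0 !andbT.
  split; apply/eqP => E; [apply: Nx|apply: Ny]; by rewrite -E.
move=> [x0 y0]; split; first by rewrite !ltW.
by move=> [[E _]|[_ E]]; [move: x0|move: y0]; rewrite E ltxx.
Qed.

Lemma integral_plane_quadrant (f : R * R -> \bar R) : measurable_fun setT f ->
  (\int[@plane_measure R]_(x in Q) f x =
   \int[(mu \x mu)%E]_(x in P `*` P) f x)%E.
Proof.
move=> mf.
have mfQ : measurable_fun (Q : set (measurableTypeR R * measurableTypeR R)) f.
  exact: measurable_funTS.
transitivity (\int[bpm]_(x in Q) f x)%E.
  exact: (@integral_completion _ _ R bpm Q f measurable_quadrant mfQ).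
rewrite (@integral_negligible_setD _ _ R bpm Q axes f measurable_axes
  measurable_quadrant mfQ axes_null).
by rewrite quadrant_setD_axes.
Qed.

(** Inputs equal almost everywhere have the same transform, and the transform of
    a Borel input is Borel, so that both integrals descend to the Borel plane. *)
Lemma quadrant_sine_norm_borel (h H : R * R -> R) (N : set (R * R)) :
  @measurable_fun _ _ (plane R) (measurableTypeR R) Q h ->
  measurable_fun setT H -> (forall x, `|H x| <= 1) ->
  measurable (N : set (measurableTypeR R * measurableTypeR R)) -> bpm N = 0%E ->
  (forall x, Q x -> ~ N x -> h x = H x) ->
  quadrant_sine_norm h = borel_sine_norm H.
Proof.
move=> mh mH H1 mN N0 hH.
have mQU : measurable (Q : set (plane R)).
  by apply: caratheodory_measurable_mu_ext; exact: measurable_quadrant.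
have sineE y : quadrant_sine h y = borel_sine H y.
  rewrite /quadrant_sine /borel_sine /Rintegral; congr fine.
  pose k x := plane_gauss x * sin (dot2 x y).
  have mk : measurable_fun setT k.
    apply: measurable_funM; first exact: measurable_plane_gauss.
    by apply: measurable_fun_sin; apply: measurable_funD; exact: measurable_funM.
  have mF := measurable_borel_integrand mH y.
  rewrite -(@integral_plane_quadrant
    (fun x => (H x * plane_gauss x * sin (dot2 x y))%:E)); last exact/measurable_EFinP.
  apply: (@ae_eq_integral _ (plane R) R (@plane_measure R) Q
    (fun x => (H x * plane_gauss x * sin (dot2 x y))%:E)
    (fun x => (h x * plane_gauss x * sin (dot2 x y))%:E)).
  - exact: mQU.
  - apply/measurable_EFinP.
    rewrite (_ : (fun x => _) = fun x => h x * k x); last first.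
      by apply/funext => x; rewrite /k mulrA.
    apply: measurable_funM => //.
    apply: (@measurable_fun_completion _ _ R bpm) => //; first exact: measurable_quadrant.
    exact: measurable_funTS.
  - apply: (@measurable_fun_completion _ _ R bpm) => //; first exact: measurable_quadrant.
    by apply: measurable_funTS; exact/measurable_EFinP.
  - exists N; split.
    + exact: caratheodory_measurable_mu_ext.
    + by rewrite -N0; exact: measurable_mu_extE.
    + move=> x /= /not_implyP[Qx]; apply: contra_notP => Nx.
      by rewrite (hH _ Qx Nx).
rewrite /quadrant_sine_norm /borel_sine_norm.
rewrite (_ : (fun y => _) = fun y => (plane_gauss y * `|borel_sine H y|)%:E); last first.
  by apply/funext => y; rewrite sineE.
apply: integral_plane_quadrant.
apply/measurable_EFinP; apply: measurable_funM; first exact: measurable_plane_gauss.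
by apply: measurableT_comp => //; exact: measurable_borel_sine.
Qed.

End plane.

(** * The sharp inequality *)

Lemma borel_sine_norm_opp (R : realType) (H : R * R -> R) :
  measurable_fun setT H -> (forall x, `|H x| <= 1) ->
  borel_sine_norm (fun x => - H x) = borel_sine_norm H.
Proof.
move=> mH H1; apply: eq_integral => y _; congr (_ * _)%:E.
suff -> : borel_sine (fun x => - H x) y = - borel_sine H y by rewrite normrN.
rewrite /borel_sine -[RHS]mulN1r -RintegralZl.
- by apply: eq_Rintegral => x _; ring.
- by apply: measurableX; exact: measurable_itv.
- exact: integrable_borel_integrand.
Qed.

Theorem theoremC1 (R : realType) :
  (forall h : R * R -> R,
     @measurable_fun _ _ (plane R) (measurableTypeR R) quadrant h ->
     (forall x, quadrant x -> -1 <= h x <= 1) ->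
     (quadrant_sine_norm h <= (pi ^+ 2 / 4 * c_Kri)%:E)%E) /\
  quadrant_sine_norm (fun _ : R * R => 1) = (pi ^+ 2 / 4 * c_Kri)%:E /\
  quadrant_sine_norm (fun _ : R * R => -1) = (pi ^+ 2 / 4 * c_Kri)%:E.
Proof.
have -> : pi ^+ 2 / 4 * c_Kri = pi / 2 * ln (1 + Num.sqrt 2) :> R.
  rewrite /c_Kri; move: (@pi R) (pi_gt0 R) => p p0.
  by field; rewrite gt_eqF.
have cst_borel (c : R) : `|c| <= 1 ->
    quadrant_sine_norm (fun _ : R * R => c) = borel_sine_norm (fun=> c).
  by move=> c1; apply: (@quadrant_sine_norm_borel _ _ _ set0).
have n1 : `|1 : R| <= 1 by rewrite normr1.
have N1 : borel_sine_norm (fun _ : R * R => 1) = (pi / 2 * ln (1 + Num.sqrt 2))%:E.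
  exact: borel_sine_norm1.
split; last split.
- move=> h mh h1.
  have nh1 x : quadrant x -> `|h x| <= 1 by move=> /h1; rewrite ler_norml.
  have [H [N [mH H1 mN N0 hH]]] := borel_modification
    (@sigma_finite_borel_plane R) (@measurable_quadrant R) mh nh1.
  rewrite (quadrant_sine_norm_borel mh mH H1 mN N0 hH).
  exact: borel_sine_norm_le.
- by rewrite cst_borel.
- have nN1 : `|- 1 : R| <= 1 by rewrite normrN.
  rewrite (cst_borel _ nN1) -N1.
  exact: (@borel_sine_norm_opp R (fun=> 1)).
Qed.
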